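(* Let $M$ be an oriented matroid on a (finite) linearly ordered set $E$. Then $$t(M;x,y)=\sum_{A\subseteq E}(x-1)^{\theta^*_M(A)}(y-1)^{\theta_M(A)},$$ where $t(M;x,y)$ denotes the Tutte polynomial of (the underlying matroid of) $M$.
   Context: The Tutte polynomial of a matroid $M$ on $E$ is $t(M;x,y)=\sum_{A\subseteq E}(x-1)^{r(M)-r_M(A)}(y-1)^{|A|-r_M(A)}$, where $r_M(A)$ is the rank of $A$ in $M$ and $r(M)=r_M(E)$; for an oriented matroid one uses the underlying matroid. Let $M$ be an oriented matroid on a finite linearly ordered set $E$. A positive circuit (resp. cocircuit) is a signed circuit (resp. cocircuit) $X=(X^+,X^-)$ with $X^-=\emptyset$. $O(M)$ is the set of elements of $E$ that are the smallest element of some positive circuit of $M$, and $O^*(M)=O(M^* )$ is the set of elements of $E$ that are the smallest element of some positive cocircuit of $M$. For $A\subseteq E$, $-_AM$ denotes the oriented matroid obtained from $M$ by reorientation on $A$ (the signs of the elements of $A$ are reversed in all signed circuits and cocircuits). Set $$\theta_M(A)=|O(-_AM)\setminus A|,\quad \theta^*_M(A)=|O^*(-_AM)\setminus A|.$$ *)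

(* Defs.v *)
From mathcomp Require Import all_boot all_order all_algebra.

Set Implicit Arguments.
Unset Strict Implicit.
Unset Printing Implicit Defensive.

Import Order.TTheory GRing.Theory.

(* Matroids on the ground set of all elements of E, by the circuit axioms.    *)
Record matroid (E : finType) := Matroid {
  circuits : {set {set E}};
  circuits_nonempty : set0 \notin circuits;
  circuits_incomparable : forall C D : {set E},
    C \in circuits -> D \in circuits -> C \subset D -> C = D;
  circuits_elimination : forall (C D : {set E}) (e : E),
    C \in circuits -> D \in circuits -> C <> D -> e \in C :&: D ->
    exists2 F : {set E}, F \in circuits & F \subset (C :|: D) :\ e
}.

Section MatroidNotions.
Variables (E : finType) (M : matroid E).

Definition indep (A : {set E}) : bool :=
  [forall C in circuits M, ~~ (C \subset A)].

Definition basis (B : {set E}) : bool := maxset indep B.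

Definition rank (A : {set E}) : nat :=
  \max_(I : {set E} | (I \subset A) && indep I) #|I|.

(* The bases of the dual matroid are the complements of the bases of M.       *)
Definition coindep (A : {set E}) : bool :=
  [exists B : {set E}, basis B && (A \subset ~: B)].

(* The cocircuits are the circuits of the dual: its minimal dependent sets.   *)
Definition cocircuits : {set {set E}} :=
  [set D : {set E} | minset (fun A => ~~ coindep A) D].

(* x and y range over any commutative ring R; taking them to be the           *)
(* indeterminates of a polynomial ring gives the Tutte polynomial itself.     *)
Definition tutte (R : comNzRingType) (x y : R) : R :=
  (\sum_(A : {set E})
     (x - 1) ^+ (rank [set: E] - rank A) * (y - 1) ^+ (#|A| - rank A))%R.

End MatroidNotions.

(* A signed set X = (X^+, X^-) is a pair of sets with signed_set X.           *)
Section SignedSets.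
Variable E : finType.
Implicit Types X Y : {set E} * {set E}.

Definition signed_set X : bool := [disjoint X.1 & X.2].

Definition supp X : {set E} := X.1 :|: X.2.

Definition opp_signed X : {set E} * {set E} := (X.2, X.1).

Definition reverse_signs (A : {set E}) X : {set E} * {set E} :=
  ((X.1 :\: A) :|: (X.2 :&: A), (X.2 :\: A) :|: (X.1 :&: A)).

(* The signs of X and Y agree somewhere iff they are opposite somewhere.      *)
Definition orthogonal X Y : bool :=
  ((X.1 :&: Y.1) :|: (X.2 :&: Y.2) == set0) ==
  ((X.1 :&: Y.2) :|: (X.2 :&: Y.1) == set0).

Definition positive X : bool := X.2 == set0.

End SignedSets.

(* Oriented matroids by the signed circuit axioms (weak elimination).         *)
Record oriented_matroid (E : finType) := OrientedMatroid {
  signed_circuits : {set {set E} * {set E}};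
  scircuits_signed : forall X, X \in signed_circuits -> signed_set X;
  scircuits_nonempty : (set0, set0) \notin signed_circuits;
  scircuits_opp : forall X,
    X \in signed_circuits -> opp_signed X \in signed_circuits;
  scircuits_incomparable : forall X Y,
    X \in signed_circuits -> Y \in signed_circuits -> supp X \subset supp Y ->
    X = Y \/ X = opp_signed Y;
  scircuits_elimination : forall X Y (e : E),
    X \in signed_circuits -> Y \in signed_circuits -> X <> opp_signed Y ->
    e \in X.1 :&: Y.2 ->
    exists2 Z, Z \in signed_circuits &
      (Z.1 \subset (X.1 :|: Y.1) :\ e) /\ (Z.2 \subset (X.2 :|: Y.2) :\ e)
}.

Section Underlying.
Variables (E : finType) (M : oriented_matroid E).

Let supports : {set {set E}} := [set supp X | X in signed_circuits M].

Lemma supp_opp (X : {set E} * {set E}) : supp (opp_signed X) = supp X.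
Proof. by rewrite /supp setUC. Qed.

Fact underlying_nonempty : set0 \notin supports.
Proof.
apply/imsetP=> -[[P N] XM] /esym/eqP; rewrite setU_eq0 => /andP[/eqP P0 /eqP N0].
by move: XM (scircuits_nonempty M); rewrite /= in P0 N0; rewrite P0 N0 => ->.
Qed.

Fact underlying_incomparable (C D : {set E}) :
  C \in supports -> D \in supports -> C \subset D -> C = D.
Proof.
move=> /imsetP[X XM ->] /imsetP[Y YM ->] sXY.
by case: (scircuits_incomparable XM YM sXY) => -> //; rewrite supp_opp.
Qed.

Fact underlying_elimination (C D : {set E}) (e : E) :
  C \in supports -> D \in supports -> C <> D -> e \in C :&: D ->
  exists2 F : {set E}, F \in supports & F \subset (C :|: D) :\ e.
Proof.
move=> /imsetP[X XM ->] /imsetP[Y YM ->] nXY.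
have elim X' Y' : X' \in signed_circuits M -> Y' \in signed_circuits M ->
    supp X' = supp X -> supp Y' = supp Y -> e \in X'.1 :&: Y'.2 ->
    exists2 F : {set E}, F \in supports & F \subset (supp X :|: supp Y) :\ e.
  move=> X'M Y'M sX sY eXY.
  have nX : X' <> opp_signed Y' by move=> E'; apply: nXY; rewrite -sX E' supp_opp.
  have [Z ZM [Z1 Z2]] := scircuits_elimination X'M Y'M nX eXY.
  exists (supp Z); first exact: imset_f.
  rewrite -sX -sY /supp subUset; apply/andP; split.
    by apply: (subset_trans Z1); rewrite setSD // setUACA subsetUl.
  by apply: (subset_trans Z2); rewrite setSD // setUACA subsetUr.
have nM := scircuits_opp.
rewrite in_setI !in_setU => /andP[/orP[eX|eX] /orP[eY|eY]].
- by apply: (elim X (opp_signed Y)); rewrite ?nM ?supp_opp // inE eX.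
- by apply: (elim X Y); rewrite // inE eX.
- by apply: (elim (opp_signed X) (opp_signed Y)); rewrite ?nM ?supp_opp // inE eX.
- by apply: (elim (opp_signed X) Y); rewrite ?nM ?supp_opp // inE eX.
Qed.

Definition underlying : matroid E :=
  Matroid underlying_nonempty underlying_incomparable underlying_elimination.

(* The signed circuits of the dual oriented matroid, i.e. the unique          *)
(* signature of the cocircuits that is orthogonal to the signed circuits.     *)
Definition signed_cocircuits : {set {set E} * {set E}} :=
  [set Y | [&& signed_set Y, supp Y \in cocircuits underlying
             & [forall X in signed_circuits M, orthogonal X Y]]].

End Underlying.

Section Reorientation.
Variables (E : finType) (M : oriented_matroid E) (A : {set E}).

Let reor : {set {set E} * {set E}} :=
  [set reverse_signs A X | X in signed_circuits M].

Lemma supp_reverse_signs (X : {set E} * {set E}) :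
  supp (reverse_signs A X) = supp X.
Proof.
apply/setP=> e; rewrite !inE.
by case: (e \in A); case: (e \in X.1); case: (e \in X.2).
Qed.

Lemma reverse_signsK : involutive (@reverse_signs E A).
Proof.
move=> [P N]; congr (_, _); apply/setP=> e; rewrite !inE /=;
  by case: (e \in A); case: (e \in P); case: (e \in N).
Qed.

Lemma reverse_signs_opp (X : {set E} * {set E}) :
  reverse_signs A (opp_signed X) = opp_signed (reverse_signs A X).
Proof. by []. Qed.

Lemma signed_set_reverse_signs (X : {set E} * {set E}) :
  signed_set (reverse_signs A X) = signed_set X.
Proof.
have sub Y : signed_set Y -> signed_set (reverse_signs A Y).
  rewrite /signed_set -!setI_eq0 => /eqP/setP dY; apply/eqP/setP=> e.
  move: (dY e); rewrite !inE.
  by case: (e \in A); case: (e \in Y.1); case: (e \in Y.2).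
by apply/idP/idP=> [/sub|/sub//]; rewrite reverse_signsK.
Qed.

Fact reorient_signed X : X \in reor -> signed_set X.
Proof.
by case/imsetP=> Y YM ->; rewrite signed_set_reverse_signs (scircuits_signed YM).
Qed.

Fact reorient_nonempty : (set0, set0) \notin reor.
Proof.
apply: contra (scircuits_nonempty M) => /imsetP[X XM /esym E0].
by rewrite -[X]reverse_signsK E0 /reverse_signs /= !set0D !set0I !setU0 in XM.
Qed.

Fact reorient_opp X : X \in reor -> opp_signed X \in reor.
Proof.
case/imsetP=> Y YM ->; rewrite -reverse_signs_opp.
by apply: imset_f; apply: scircuits_opp.
Qed.

Fact reorient_incomparable X Y :
  X \in reor -> Y \in reor -> supp X \subset supp Y ->
  X = Y \/ X = opp_signed Y.
Proof.
move=> /imsetP[X' XM ->] /imsetP[Y' YM ->]; rewrite !supp_reverse_signs => sXY.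
case: (scircuits_incomparable XM YM sXY) => ->; first by left.
by right; rewrite reverse_signs_opp.
Qed.

Fact reorient_elimination X Y (e : E) :
  X \in reor -> Y \in reor -> X <> opp_signed Y -> e \in X.1 :&: Y.2 ->
  exists2 Z, Z \in reor &
    (Z.1 \subset (X.1 :|: Y.1) :\ e) /\ (Z.2 \subset (X.2 :|: Y.2) :\ e).
Proof.
move=> /imsetP[X' XM ->] /imsetP[Y' YM ->] nXY eXY.
have nXY' : X' <> opp_signed Y' by move=> E'; apply: nXY; rewrite E'.
have nYX' : Y' <> opp_signed X'.
  by move=> E'; apply: nXY'; rewrite E'; case: (X').
have lift Z : Z \in signed_circuits M ->
    Z.1 \subset (X'.1 :|: Y'.1) :\ e -> Z.2 \subset (X'.2 :|: Y'.2) :\ e ->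
    exists2 Z, Z \in reor &
    (Z.1 \subset ((reverse_signs A X').1 :|: (reverse_signs A Y').1) :\ e) /\
    (Z.2 \subset ((reverse_signs A X').2 :|: (reverse_signs A Y').2) :\ e).
  move=> ZM /subsetP Z1 /subsetP Z2.
  exists (reverse_signs A Z); first exact: imset_f.
  split; apply/subsetP=> f; move: (Z1 f) (Z2 f); rewrite !inE;
  case: (f \in A); case: (f \in Z.1); case: (f \in Z.2); case: (f == e);
  case: (f \in X'.1); case: (f \in X'.2); case: (f \in Y'.1);
  by case: (f \in Y'.2) => //= h1 h2; do ?[exact: h1 | exact: h2].
have [eA|eA] := boolP (e \in A).
  have eYX : e \in Y'.1 :&: X'.2 by move: eXY; rewrite !inE eA /= !andbT andbC.
  have [Z ZM [Z1 Z2]] := scircuits_elimination YM XM nYX' eYX.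
  by apply: (lift Z ZM); rewrite setUC.
have eXY' : e \in X'.1 :&: Y'.2.
  by move: eXY; rewrite !inE (negbTE eA) /= !andbF !orbF.
by have [Z ZM [Z1 Z2]] := scircuits_elimination XM YM nXY' eXY'; apply: (lift Z).
Qed.

Definition reorient : oriented_matroid E :=
  OrientedMatroid reorient_signed reorient_nonempty reorient_opp
    reorient_incomparable reorient_elimination.

Lemma circuits_reorient : circuits (underlying reorient) = circuits (underlying M).
Proof.
rewrite /= -imset_comp; apply: eq_imset => X /=; exact: supp_reverse_signs.
Qed.

Lemma orthogonal_reverse_signs (X Y : {set E} * {set E}) :
  orthogonal (reverse_signs A X) (reverse_signs A Y) = orthogonal X Y.
Proof.
rewrite /orthogonal.
have eq0 (S T : {set E}) : S =i T -> (S == set0) = (T == set0).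
  by move=> /setP->.
by congr (_ == _); apply: eq0 => e; rewrite !inE;
  case: (e \in A); case: (e \in X.1); case: (e \in X.2); case: (e \in Y.1);
  case: (e \in Y.2).
Qed.

Lemma signed_cocircuits_reorient :
  signed_cocircuits reorient =
  [set reverse_signs A Y | Y in signed_cocircuits M].
Proof.
have eqC : cocircuits (underlying reorient) = cocircuits (underlying M).
  by rewrite /cocircuits /coindep /basis /indep circuits_reorient.
apply/setP=> Y; rewrite -[Y]reverse_signsK.
rewrite (mem_imset _ _ (inv_inj reverse_signsK)) [LHS]in_set [RHS]in_set.
rewrite signed_set_reverse_signs supp_reverse_signs eqC; congr [&& _, _ & _].
apply/forall_inP/forall_inP=> oY X XM.
  by rewrite -orthogonal_reverse_signs oY // imset_f.
by case/imsetP: XM => X' XM ->; rewrite orthogonal_reverse_signs oY.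
Qed.

End Reorientation.

Section Activities.
Variables (disp : Order.disp_t) (E : finOrderType disp).

Definition is_smallest (e : E) (A : {set E}) : bool :=
  (e \in A) && [forall f in A, (e <= f)%O].

Definition O_set (M : oriented_matroid E) : {set E} :=
  [set e | [exists X in signed_circuits M,
              positive X && is_smallest e (supp X)]].

Definition O_star_set (M : oriented_matroid E) : {set E} :=
  [set e | [exists Y in signed_cocircuits M,
              positive Y && is_smallest e (supp Y)]].

Definition theta (M : oriented_matroid E) (A : {set E}) : nat :=
  #|O_set (reorient M A) :\: A|.

Definition theta_star (M : oriented_matroid E) (A : {set E}) : nat :=
  #|O_star_set (reorient M A) :\: A|.

End Activities.

(* Main.v *)
Require Import Defs.
From mathcomp Require Import all_boot all_order all_algebra.
From mathcomp Require Import zify.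

(** The proof is a deletion-contraction argument along the linear order, from
    the largest element down.  A minor of M is encoded by two sets L and L'
    covering E: the elements outside L are deleted, those outside L' are
    contracted, and P = L :&: L' is what remains.  No minor is ever formed: an
    element is active in the minor when some circuit of M inside L, with signs
    examined on P only, has it as the smallest element of its trace on P
    ([active]).  Exchanging L with L' and circuits with cocircuits is duality,
    so every one-sided statement about deletion is also one about contraction.

    Let e be the largest element of P, let A be a subset of P not containing e,
    and compare the reorientations on A and on e |: A.  The crux
    ([active_minors]) is that the pairs (O, O^* ), stripped of e, attached to
    these two reorientations are, in one order or the other, the pairs attached
    to A in the contraction and in the deletion of e.  Indeed a circuit
    witnessing activity in the contraction can have either sign at e, so O of
    the contraction is the union of the two sets O; circuits of opposite signs
    at e can be eliminated, so O of the deletion is their intersection; dually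
    for O^*.  Moreover the two sets O are nested, the two sets O^* are nested
    the other way round ([toggle_nested]).  If e is a loop or a coloop, then all
    these pairs coincide and e itself contributes a factor y or x.  Hence the
    activity sum and the corank-nullity sum satisfy the same recursion
    ([activity_sum_rec], [rank_sum_rec]) and agree.

    Eliminations are obtained from the painting property of [dual_pair]: for
    every L, L' covering E, every choice of signs on P and every e in P, either a
    circuit inside L or a cocircuit inside L' passes through e and has the chosen
    signs on P; orthogonality forbids both at once.  By induction on P
    ([circuits_dual_pair]) this reduces to P = [set e], that is, to the unsigned
    dichotomy of Minty ([circuit_or_cocircuit]) and to the existence of an
    orthogonal signature on each cocircuit ([signed_cocircuit_exists]).  The
    latter rests on [visible_elimination], a form of weak elimination:
    elimination remains possible when signs are controlled only on a set D, with
    the guarantee that the resulting circuit meets D. *)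

Set Implicit Arguments.
Unset Strict Implicit.
Unset Printing Implicit Defensive.

Import Order.TTheory GRing.Theory.

(** * Rank, circuits and cocircuits of a matroid *)

Section MatroidTheory.
Variables (E : finType) (M : matroid E).
Implicit Types (A B C D G I J K L R : {set E}) (e f : E).

(** For e in L, the negation says that e is a coloop of the restriction to L. *)
Definition on_circuit L e : bool :=
  [exists C in circuits M, (e \in C) && (C \subset L)].

Lemma indep_sub A B : A \subset B -> indep M B -> indep M A.
Proof.
move=> sAB /forall_inP iB; apply/forall_inP=> C CM.
by apply: contra (iB C CM) => /subset_trans; apply.
Qed.

Lemma indep0 : indep M set0.
Proof.
apply/forall_inP=> C CM; rewrite subset0; apply: contraTneq CM => ->.
exact: circuits_nonempty.
Qed.

Lemma dependentP A :
  reflect (exists2 C, C \in circuits M & C \subset A) (~~ indep M A).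
Proof.
rewrite negb_forall_in; apply: (iffP exists_inP) => -[C CM];
  by rewrite ?negbK => sCA; exists C; rewrite ?negbK.
Qed.

(** Among the independent subsets of I :|: J larger than I, take a K missing as
    few elements of I as possible.  If K contains I, an element of K outside I
    does the job.  Otherwise some e in I is not in K, and exchanging any f of
    K :\: I for e creates a circuit through e avoiding f, by the choice of K.
    Two distinct such circuits exist, and eliminating e between them gives a
    circuit inside K. *)
Lemma indep_augment I J :
    indep M I -> indep M J -> #|I| < #|J| ->
  exists2 f, f \in J :\: I & indep M (f |: I).
Proof.
move=> iI iJ ltIJ; apply/exists_inP; case: (boolP [exists _ in _, _]) => // /exists_inPn noaug.
pose good K := [&& indep M K, K \subset I :|: J & #|I| < #|K|].
have gJ : good J by rewrite /good iJ subsetUr ltIJ.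
case: (arg_minnP (fun K => #|I :\: K|) gJ) => K /and3P[iK sK ltIK] minK.
have [sIK|/subsetPn[e eI eK]] := boolP (I \subset K).
  have /properP[_ [f fK fI]] : I \proper K.
    by rewrite properE sIK; apply: contraTN ltIK => /subset_leq_card; rewrite -leqNgt.
  have fJ : f \in J :\: I.
    by rewrite inE fI; have := subsetP sK f fK; rewrite inE (negPf fI).
  by have /negP[] := noaug f fJ; apply: indep_sub iK; rewrite subUset sub1set fK.
have circ f : f \in K :\: I ->
    exists2 C, C \in circuits M & (C \subset (e |: K) :\ f) /\ e \in C.
  rewrite inE => /andP[fI fK].
  have cardT : #|(e |: K) :\ f| = #|K|.
    have := cardsD1 f (e |: K); rewrite cardsU1 !inE eK fK orbT.
    by rewrite !add1n => -[<-].
  have : ~~ good ((e |: K) :\ f).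
    apply/negP=> gT; have := minK _ gT; rewrite leqNgt => /negP[].
    apply: proper_card; apply/properP; split.
      apply/subsetP=> x; rewrite !inE negb_and negbK negb_or => /andP[].
      by case/orP=> [/eqP->|/andP[_ ->]] // xI; rewrite xI in fI.
    exists e; rewrite !inE eI ?eK //= eqxx /= !andbT negbK.
    by apply: contraNneq eK => ->.
  rewrite /good cardT ltIK andbT negb_and => /orP[/dependentP[C CM sC]|].
    exists C => //; split=> //; apply/negPn/negP => eC.
    have /forall_inP/(_ C CM)/negP[] := iK.
    apply/subsetP=> x xC; have := subsetP sC x xC; rewrite !inE.
    by case/andP=> _ /orP[/eqP xe|//]; rewrite -xe xC in eC.
  case/negP; apply/subsetP=> x; rewrite !inE => /andP[_ /orP[/eqP->|xK]].
    by rewrite eI.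
  by have := subsetP sK x xK; rewrite inE.
have [g gK] : exists g, g \in K :\: I.
  apply/set0Pn; rewrite setD_eq0; apply: contraTN ltIK => /subset_leq_card.
  by rewrite -leqNgt.
have [C CM [sC eC]] := circ g gK.
have [h hC hK] : exists2 h, h \in C & h \in K :\: I.
  have /forall_inP/(_ C CM)/subsetPn[h hC hI] := iI.
  exists h => //; rewrite inE hI; have := subsetP sC h hC; rewrite !inE.
  by case/andP=> _ /orP[/eqP he|//]; rewrite he eI in hI.
have [C' CM' [sC' eC']] := circ h hK.
have neC : C <> C'.
  by move=> eqC; have := subsetP sC' h; rewrite -eqC hC !inE eqxx => /(_ isT).
have [|F FM sF] := circuits_elimination CM CM' neC (e := e); first by rewrite inE eC.
have /forall_inP/(_ F FM)/negP[] := iK.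
apply: subset_trans sF _; apply/subsetP=> x; rewrite !inE => /andP[xe].
by case/orP=> [/(subsetP sC)|/(subsetP sC')]; rewrite !inE (negPf xe) => /andP[].
Qed.

Lemma rank_ge I A : I \subset A -> indep M I -> #|I| <= rank M A.
Proof. by move=> sIA iI; apply: leq_bigmax_cond; rewrite sIA. Qed.

Lemma rank_witness A :
  exists I, [/\ I \subset A, indep M I & #|I| = rank M A].
Proof.
have [|I /andP[sIA iI] eI] :=
  @eq_bigmax_cond _ (fun I : {set E} => (I \subset A) && indep M I) (fun I => #|I|).
  by apply/card_gt0P; exists set0; rewrite unfold_in /= sub0set indep0.
by exists I.
Qed.

Lemma rankS A B : A \subset B -> rank M A <= rank M B.
Proof.
by move=> sAB; have [I [sIA iI <-]] := rank_witness A; rewrite rank_ge ?(subset_trans sIA).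
Qed.

Lemma rank0 : rank M set0 = 0.
Proof.
by have [I [+ _ <-]] := rank_witness set0; rewrite subset0 => /eqP->; rewrite cards0.
Qed.

Lemma indep_extend I A : I \subset A -> indep M I ->
  exists J, [/\ I \subset J, J \subset A, indep M J & #|J| = rank M A].
Proof.
move=> sIA iI; pose good K := [&& I \subset K, K \subset A & indep M K].
have gI : good I by rewrite /good subxx sIA.
case: (arg_maxnP (fun K => #|K|) gI) => K /and3P[sIK sKA iK] maxK.
exists K; split=> //; apply/eqP; rewrite eqn_leq rank_ge //= leqNgt; apply/negP.
have [B [sBA iB <-]] := rank_witness A => /(indep_augment iK iB)[f fB ifK].
have [fA fK] : f \in A /\ f \notin K.
  by move: fB; rewrite inE => /andP[? /(subsetP sBA)].
have /maxK : good (f |: K).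
  by rewrite /good ifK subUset sub1set fA sKA (subset_trans sIK) ?subsetUr.
by rewrite /= cardsU1 fK add1n ltnn.
Qed.

Lemma basisE B : basis M B = indep M B && (#|B| == rank M [set: E]).
Proof.
apply/idP/andP => [/maxsetP[iB maxB]|[iB /eqP cB]].
  split=> //; have [J [sBJ _ iJ cJ]] := indep_extend (subsetT B) iB.
  by rewrite -cJ (maxB J iJ sBJ).
apply/maxsetP; split=> // K iK sBK; apply/esym/eqP.
by rewrite eqEcard sBK cB rank_ge ?subsetT.
Qed.

(** A circuit through e inside L, deprived of e, extends to a largest independent
    subset of L :\ e; enlarging the latter inside L could only use e, which would
    recreate the circuit.  Without such a circuit, adding e preserves
    independence. *)
Lemma rankD1 L e : e \in L -> rank M L = rank M (L :\ e) + ~~ on_circuit L e.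
Proof.
move=> eL; have sD : L :\ e \subset L by exact: subsetDl.
case: (boolP (on_circuit L e)) => [/exists_inP[C CM /andP[eC sCL]]|noC]; last first.
  have [I [sI iI cI]] := rank_witness (L :\ e).
  have eI : e \notin I by apply/negP=> /(subsetP sI); rewrite !inE eqxx.
  have iI' : indep M (e |: I).
    apply/forall_inP=> C CM; apply/negP=> sC; have [eC|eC] := boolP (e \in C).
      case/exists_inP: noC; exists C => //; rewrite eC (subset_trans sC) //.
      by rewrite subUset sub1set eL (subset_trans sI).
    have /forall_inP/(_ C CM)/negP[] := iI.
    apply/subsetP=> x xC; have := subsetP sC x xC; rewrite !inE.
    by case/orP=> [/eqP xe|//]; rewrite -xe xC in eC.
  apply/eqP; rewrite /= addn1 eqn_leq; apply/andP; split; last first.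
    rewrite -cI -[_.+1]add1n; have := rank_ge (I := e |: I) (A := L) _ iI'.
    rewrite cardsU1 eI; apply.
    by rewrite subUset sub1set eL (subset_trans sI).
  have [J [sJ iJ <-]] := rank_witness L.
  rewrite (cardsD1 e J) -add1n leq_add ?leq_b1 // rank_ge ?setSD //.
  by apply: indep_sub iJ; exact: subsetDl.
rewrite addn0; apply/eqP; rewrite eqn_leq (rankS sD) andbT leqNgt; apply/negP.
have iC : indep M (C :\ e).
  apply/forall_inP=> C' CM'; apply/negP=> sC'.
  have eqC := circuits_incomparable CM' CM (subset_trans sC' (subsetDl _ _)).
  by have := subsetP sC' e; rewrite eqC eC !inE eqxx => /(_ isT).
have [I [sCI sI iI cI]] := indep_extend (setSD [set e] sCL) iC.
have [J [sJ iJ <-]] := rank_witness L; rewrite -cI => /(indep_augment iI iJ)[f].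
rewrite inE => /andP[fI /(subsetP sJ) fL] ifI.
have [fe|fe] := eqVneq f e.
  have /forall_inP/(_ C CM)/negP[] := ifI.
  by rewrite fe -(setD1K eC) setUS.
suff /rank_ge/(_ ifI) : f |: I \subset L :\ e by rewrite cardsU1 fI cI add1n ltnn.
by rewrite subUset sub1set !inE fe fL.
Qed.

Lemma coindepE D : coindep M D = (rank M (~: D) == rank M [set: E]).
Proof.
apply/existsP/eqP => [[B /andP[]]|eqr].
  rewrite basisE => /andP[iB /eqP cB]; rewrite subsetC => sB.
  by apply/eqP; rewrite eqn_leq rankS ?subsetT // -cB rank_ge.
have [B [sB iB cB]] := rank_witness (~: D).
by exists B; rewrite basisE iB cB eqr eqxx subsetC.
Qed.

(** If C met D in e only, adding e to the complement of D would not raise the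
    rank, because of C; but D :\ e is coindependent and D is not. *)
Lemma circuit_cocircuit_neq1 C D e :
  C \in circuits M -> D \in cocircuits M -> C :&: D <> [set e].
Proof.
move=> CM; rewrite inE => /minsetP[/negP nD minD] eqCD.
have /setIP[eC eD] : e \in C :&: D by rewrite eqCD set11.
apply: nD; rewrite coindepE; have cD : coindep M (D :\ e).
  case: (boolP (coindep M (D :\ e))) => // /minD/(_ (subsetDl _ _)) eqD.
  by move: eD; rewrite -eqD !inE eqxx.
rewrite coindepE (rankD1 (e := e)) in cD; last by rewrite !inE eqxx.
have eqDC : ~: (D :\ e) :\ e = ~: D.
  by apply/setP=> x; rewrite !inE; case: eqP => [->|]; rewrite ?eD.
rewrite eqDC in cD; suff circ : on_circuit (~: (D :\ e)) e by rewrite circ addn0 in cD.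
apply/exists_inP; exists C => //; rewrite eC; apply/subsetP=> x xC.
rewrite !inE negb_and negbK; have /setP/(_ x) := eqCD; rewrite !inE xC /= => ->.
exact: orbN.
Qed.

(** If e lies on no circuit inside L, a largest independent subset I of L :\ e
    can be enlarged by e, hence extended to a basis B through e.  The elements
    that can replace e in B form a cocircuit; it avoids L :\ e, because I is
    already maximal there. *)
Lemma circuit_or_cocircuit L L' e :
    L :|: L' = [set: E] -> L :&: L' = [set e] ->
  on_circuit L e \/ exists2 D, D \in cocircuits M & (e \in D) && (D \subset L').
Proof.
move=> LL' eLL'; have [|noC] := boolP (on_circuit L e); [by left | right].
have eL : e \in L by have /setIP[] : e \in L :&: L' by rewrite eLL' set11.
have [I [sI iI cI]] := rank_witness (L :\ e).
have [J [sJ iJ cJ]] := rank_witness L.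
have ltIJ : #|I| < #|J| by rewrite cJ (rankD1 eL) noC cI addn1.
have [f /setDP[fJ fI] ifI] := indep_augment iI iJ ltIJ.
have fe : f = e.
  apply/eqP; apply: contraT => fe.
  suff /rank_ge/(_ ifI) : f |: I \subset L :\ e by rewrite cardsU1 fI cI add1n ltnn.
  by rewrite subUset sub1set !inE fe sI (subsetP sJ).
rewrite {f fJ}fe in fI ifI.
have [B [sIB _ iB cB]] := indep_extend (subsetT _) ifI.
have eB : e \in B by apply: (subsetP sIB); rewrite setU11.
have iBe : indep M (B :\ e) by apply: indep_sub iB; exact: subsetDl.
have cBe : #|B :\ e|.+1 = rank M [set: E] by rewrite -cB (cardsD1 e B) eB.
pose D := [set f | (f \notin B :\ e) && indep M (f |: B :\ e)].
have eD : e \in D by rewrite !inE eqxx /= setD1K.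
exists D; last first.
  rewrite eD; apply/subsetP=> f; rewrite in_set => /andP[fB ifB].
  have := in_setT f; rewrite -LL' in_setU => /orP[fL|//].
  have [->|fe] := eqVneq f e; first by have /setIP[] : e \in L :&: L' by rewrite eLL' set11.
  have sIBe : I \subset B :\ e.
    apply/subsetP=> x xI; rewrite !inE (subsetP sIB) ?inE ?xI ?orbT // andbT.
    by apply: contraNneq fI => <-.
  have fI' : f \notin I by apply: contra fB => /(subsetP sIBe).
  have ifI' : indep M (f |: I) by apply: indep_sub ifB; rewrite setUS.
  suff /rank_ge/(_ ifI') : f |: I \subset L :\ e by rewrite cardsU1 fI' cI add1n ltnn.
  by rewrite subUset sub1set !inE fe sI fL.
rewrite inE; apply/minsetP; split.
  rewrite coindepE; apply/negP=> /eqP eqr.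
  have [K [sK iK cK]] := rank_witness (~: D).
  have [|f /setDP[fK fB] ifB] := indep_augment iBe iK; first by rewrite cK eqr cBe.
  by have := subsetP sK f fK; rewrite in_setC in_set fB ifB.
move=> D' nD' sD'; apply/eqP; rewrite eqEsubset sD' /=.
apply/subsetP=> f; rewrite in_set => /andP[fB ifB].
apply/negPn/negP=> fD'; case/negP: nD'; apply/existsP; exists (f |: B :\ e).
rewrite basisE ifB cardsU1 fB add1n cBe eqxx /= subsetC subUset sub1set inE fD'.
apply/subsetP=> x xB; rewrite inE; apply: contraL xB => /(subsetP sD').
by rewrite in_set => /andP[].
Qed.

End MatroidTheory.

(** * Elimination with signs controlled on a given set *)

Section VisibleElimination.
Variables (E : finType) (M : oriented_matroid E).
Implicit Types (X Y Z W : {set E} * {set E}) (D U : {set E}) (e g h : E).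
Local Notation SC := (signed_circuits M).

(** The condition on g under which g can be eliminated between X and Y. *)
Definition opposed X Y g : bool :=
  (g \in X.1) && (g \in Y.2) || (g \in X.2) && (g \in Y.1).

Lemma in_supp X g : (g \in supp X) = (g \in X.1) || (g \in X.2).
Proof. by rewrite in_setU. Qed.

Lemma opp_signedK : involutive (@opp_signed E).
Proof. by case. Qed.

Lemma circuit_signN X g : X \in SC -> g \in X.1 -> g \in X.2 = false.
Proof. by move/scircuits_signed => /disjointFr; apply. Qed.

Lemma supp_circuit X : X \in SC -> supp X \in circuits (underlying M).
Proof. by move=> XM; apply/imsetP; exists X. Qed.

Lemma supp_antisym X Y :
  X \in SC -> Y \in SC -> supp X \subset supp Y -> supp X = supp Y.
Proof. by move=> XM YM; apply: circuits_incomparable; apply: supp_circuit. Qed.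

Lemma signed_elimination X Y g :
    X \in SC -> Y \in SC -> X <> opp_signed Y -> opposed X Y g ->
  exists2 Z, Z \in SC & Z.1 \subset (X.1 :|: Y.1) :\ g /\ Z.2 \subset (X.2 :|: Y.2) :\ g.
Proof.
move=> XM YM nXY /orP[gXY|gXY].
  by apply: scircuits_elimination; rewrite // inE.
rewrite (setUC X.1) (setUC X.2); apply: scircuits_elimination => //; last by rewrite inE andbC.
by move=> eqY; apply: nXY; rewrite eqY opp_signedK.
Qed.

(** Only the signs of X are recorded: replacing Z by its opposite makes X and Z
    opposed at g. *)
Lemma support_elimination X Z g :
    X \in SC -> Z \in SC -> supp X != supp Z -> g \in supp X -> g \in supp Z ->
  exists2 W, W \in SC &
    [/\ supp W \subset (supp X :|: supp Z) :\ g, W.1 \subset X.1 :|: supp Z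
      & W.2 \subset X.2 :|: supp Z].
Proof.
move=> XM; have elim Z' : Z' \in SC -> supp X != supp Z' -> opposed X Z' g ->
    exists2 W, W \in SC &
    [/\ supp W \subset (supp X :|: supp Z') :\ g, W.1 \subset X.1 :|: supp Z'
      & W.2 \subset X.2 :|: supp Z'].
  move=> ZM nXZ op; have [|W WM [/subsetP W1 /subsetP W2]] := signed_elimination XM ZM _ op.
    by move=> eqX; rewrite eqX supp_opp eqxx in nXZ.
  exists W => //; split; apply/subsetP=> x; rewrite ?in_setD1 ?inE.
  - by case/orP=> [/W1|/W2]; rewrite !inE => /andP[->] /orP[]->; rewrite ?orbT.
  - by move/W1; rewrite !inE => /andP[_] /orP[]->; rewrite ?orbT.
  - by move/W2; rewrite !inE => /andP[_] /orP[]->; rewrite ?orbT.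
move=> ZM nXZ gX gZ; have [op|op] := boolP (opposed X Z g); first exact: elim.
rewrite -(supp_opp Z); apply: elim; rewrite ?scircuits_opp ?supp_opp //.
move: gX gZ op; rewrite !in_supp /opposed /=.
by case: (g \in X.1); case: (g \in X.2); case: (g \in Z.1); case: (g \in Z.2).
Qed.

(** Choose the circuit Z inside U :\: D with as few elements outside Y as
    possible, and eliminate an element a of Z from Y by means of Z, which leaves
    the signs on D untouched.  If the outcome W missed D, it would have exactly
    as many elements outside Y as Z by minimality; eliminating one of them
    between Z and W would then produce a circuit contradicting the choice of Z.
    So W is a circuit with part of the trace of Y on D, inside a smaller set. *)
Lemma shrink_keeping_trace D U Y Z0 :
    Y \in SC -> supp Y \subset U -> supp Y :&: D != set0 ->
    Z0 \in SC -> supp Z0 \subset U :\: D ->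
  exists2 Z, Z \in SC & supp Z \subset U :\: D /\
    forall a, a \in supp Z -> a \in supp Y ->
    exists2 W, W \in SC &
      [/\ supp W \subset (supp Y :|: supp Z) :\ a, supp W :&: D != set0,
          W.1 :&: D \subset Y.1 & W.2 :&: D \subset Y.2].
Proof.
move=> YM sYU meetY Z0M sZ0.
pose good Z := (Z \in SC) && (supp Z \subset U :\: D).
have good0 : good Z0 by rewrite /good Z0M.
case: (arg_minnP (fun Z => #|supp Z :\: supp Y|) good0) => Z /andP[ZM sZ] minZ.
exists Z => //; split=> // a aZ aY.
have ZD x : x \in supp Z -> x \notin D.
  by move/(subsetP sZ); rewrite inE => /andP[].
have neYZ : supp Y != supp Z.
  apply: contraNneq meetY => eqYZ; apply/eqP/setP=> x; rewrite in_setI in_set0 eqYZ.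
  by apply/negP=> /andP[/ZD/negP].
have [W WM [sW W1 W2]] := support_elimination YM ZM neYZ aY aZ.
exists W => //; split=> //; last 2 first.
- apply/subsetP=> x; rewrite inE => /andP[/(subsetP W1) + xD]; rewrite in_setU.
  by case/orP=> // /ZD; rewrite xD.
- apply/subsetP=> x; rewrite inE => /andP[/(subsetP W2) + xD]; rewrite in_setU.
  by case/orP=> // /ZD; rewrite xD.
apply/negP=> WD0.
have gW : good W.
  rewrite /good WM; apply/subsetP=> x xW; have := subsetP sW x xW.
  have := disjointFr (_ : [disjoint supp W & D]) xW.
  rewrite -setI_eq0 WD0 !in_setD in_setU => /(_ isT)-> /andP[_] /orP[/(subsetP sYU)->|] //.
  by move/(subsetP sZ); rewrite in_setD => /andP[].
have sWZ : supp W :\: supp Y \subset supp Z :\: supp Y.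
  apply/subsetP=> x; rewrite !in_setD => /andP[xY /(subsetP sW)].
  by rewrite in_setD1 in_setU (negPf xY) => /andP[_].
have eqWZ : supp W :\: supp Y = supp Z :\: supp Y.
  by apply/eqP; rewrite eqEcard sWZ; apply: minZ.
have [b bW bY] : exists2 b, b \in supp W & b \notin supp Y.
  apply/subsetPn; apply: contra meetY => /(supp_antisym WM YM) <-.
  by rewrite WD0.
have bZ : b \in supp Z.
  by have /setDP[] : b \in supp Z :\: supp Y by rewrite -eqWZ in_setD bW bY.
have neZW : supp Z != supp W.
  by apply: contraTneq aZ => ->; apply/negP=> /(subsetP sW); rewrite in_setD1 eqxx.
have [V VM [sV _ _]] := support_elimination ZM WM neZW bZ bW.
have gV : good V.
  rewrite /good VM; apply: subset_trans sV _; apply: subset_trans (subsetDl _ _) _.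
  by rewrite subUset sZ; case/andP: gW.
have := minZ V gV; rewrite leqNgt => /negP[]; apply: proper_card.
apply/properP; split; last first.
  by exists b; rewrite !in_setD ?bY ?bZ //=; apply/negP=> /(subsetP sV); rewrite in_setD1 eqxx.
apply/subsetP=> x; rewrite !in_setD => /andP[xY /(subsetP sV)].
rewrite in_setD1 in_setU xY => /andP[_] /orP[//|xW].
by have := subsetP sWZ x; rewrite !in_setD xY xW => /(_ isT).
Qed.

(** Weak elimination in the contraction of the complement of D, where circuits
    are traces on D.  A first elimination of g gives a circuit Z that has the
    required signs but may miss D.  In that case Y can be replaced, by
    [shrink_keeping_trace], with a circuit W that lacks an element of Y outside
    X; then W either avoids g, and is the desired circuit, or is opposed to X at
    g with a smaller union.  The element h, at which X and Y are not opposed,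
    prevents W from becoming the opposite of X. *)
Lemma visible_elimination D X Y g h :
    X \in SC -> Y \in SC -> g \in D -> opposed X Y g ->
    h \in supp X :&: D -> ~~ opposed X Y h ->
  exists2 Z, Z \in SC & [/\ supp Z :&: D != set0, g \notin supp Z,
    Z.1 :&: D \subset X.1 :|: Y.1 & Z.2 :&: D \subset X.2 :|: Y.2].
Proof.
move=> XM + gD; move: {2}_.+1 (ltnSn #|supp X :|: supp Y|) => n.
elim: n Y => // n IHn Y; rewrite ltnS => leXY YM opg hXD nop.
have [hX hD] := setIP hXD.
have nXY : X <> opp_signed Y.
  move=> eqX; move: hX nop; rewrite eqX in_supp /opposed /= !andbb.
  by move->.
have [Z ZM [sZ1 sZ2]] := signed_elimination XM YM nXY opg.
have [/eqP ZD|ZD] := boolP (supp Z :&: D == set0); last first.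
  exists Z => //; split=> //.
  - by rewrite in_supp; apply/negP=> /orP[/(subsetP sZ1)|/(subsetP sZ2)];
      rewrite in_setD1 eqxx.
  - by apply: subset_trans (subsetIl _ _) (subset_trans sZ1 (subsetDl _ _)).
  - by apply: subset_trans (subsetIl _ _) (subset_trans sZ2 (subsetDl _ _)).
have gX : g \in supp X by rewrite in_supp; case/orP: opg => /andP[-> _]; rewrite ?orbT.
have gY : g \in supp Y by rewrite in_supp; case/orP: opg => /andP[_ ->]; rewrite ?orbT.
have meet T : g \in supp T -> supp T :&: D != set0.
  by move=> gT; apply/set0Pn; exists g; rewrite inE gT.
have sZ : supp Z \subset (supp X :|: supp Y) :\: D.
  apply/subsetP=> x xZ; rewrite in_setD; have -> /= : x \notin D.
    by apply/negP=> xD; have := in_set0 x; rewrite -ZD inE xZ xD.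
  move: xZ; rewrite !inE => /orP[/(subsetP sZ1)|/(subsetP sZ2)]; rewrite !inE => /andP[_];
  by case/orP=> ->; rewrite ?orbT.
have [Z' ZM' [sZ' red]] := shrink_keeping_trace YM (subsetUr _ _) (meet Y gY) ZM sZ.
have [a aZ aX] : exists2 a, a \in supp Z' & a \notin supp X.
  apply/subsetPn/negP=> /(supp_antisym ZM' XM) eqZ.
  by have := subsetP sZ' g; rewrite eqZ gX in_setD gD => /(_ isT).
have aY : a \in supp Y by have := subsetP sZ' a aZ; rewrite !in_setD in_setU (negPf aX) => /andP[].
have [W WM [sW WD W1 W2]] := red a aZ aY.
have sW1 : W.1 :&: D \subset X.1 :|: Y.1 by apply: subset_trans W1 (subsetUr _ _).
have sW2 : W.2 :&: D \subset X.2 :|: Y.2 by apply: subset_trans W2 (subsetUr _ _).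
have [gW|gW] := boolP (g \in supp W); last by exists W.
have W1D x : x \in W.1 -> x \in D -> x \in Y.1.
  by move=> xW xD; apply: (subsetP W1); rewrite inE xW.
have W2D x : x \in W.2 -> x \in D -> x \in Y.2.
  by move=> xW xD; apply: (subsetP W2); rewrite inE xW.
have [] := IHn W _ WM _ hXD.
- apply: leq_trans leXY; apply: proper_card; apply/properP; split.
    rewrite subUset subsetUl /=; apply: subset_trans sW _.
    apply: subset_trans (subsetDl _ _) _; rewrite subUset subsetUr /=.
    by apply: subset_trans sZ' (subsetDl _ _).
  exists a; rewrite in_setU ?aY ?orbT // (negPf aX) /=.
  by apply/negP=> /(subsetP sW); rewrite in_setD1 eqxx.
- move: opg gW; rewrite /opposed in_supp => /orP[] /andP[gx gy] /orP[] gw.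
  + by have := circuit_signN YM (W1D g gw gD); rewrite gy.
  + by rewrite gx gw.
  + by rewrite gx gw orbT.
  + by have := circuit_signN YM gy; rewrite (W2D g gw gD).
- apply: contra nop => /orP[] /andP[hx hw]; rewrite /opposed hx.
    by rewrite (W2D h hw hD).
  by rewrite (W1D h hw hD) orbT.
move=> V VM [VD gV V1 V2]; exists V => //; split=> //.
  apply/subsetP=> x xV; have := subsetP V1 x xV; rewrite !in_setU.
  by case/orP=> [->//|/W1D->]; rewrite ?orbT //; case/setIP: xV.
apply/subsetP=> x xV; have := subsetP V2 x xV; rewrite !in_setU.
by case/orP=> [->//|/W2D->]; rewrite ?orbT //; case/setIP: xV.
Qed.

End VisibleElimination.

(** * Signatures of cocircuits *)

Section CocircuitSignature.
Variables (E : finType) (M : oriented_matroid E).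
Implicit Types (X Y Z : {set E} * {set E}) (D : {set E}) (e g : E).
Local Notation SC := (signed_circuits M).

(** Fix e in D.  For each other g in D some circuit meets D in e and g only
    (otherwise, by Minty's dichotomy, D :\ g would contain a cocircuit), and the
    sign of g is dictated by orthogonality to this circuit.  The sign is well
    defined and the signature is orthogonal to every circuit for the same reason:
    [visible_elimination] would lead to a circuit meeting D in one element. *)
Lemma signed_cocircuit_exists D :
  D \in cocircuits (underlying M) -> exists2 Y, Y \in signed_cocircuits M & supp Y = D.
Proof.
move=> DM; have [D0|[e eD]] := set_0Vmem D.
  have s0 : supp (set0, set0) = D by rewrite D0 /supp /= setU0.
  exists (set0, set0) => //; rewrite inE s0 DM /=; apply/andP; split.
    by rewrite /signed_set -setI_eq0 setI0.
  by apply/forall_inP=> X _; rewrite /Defs.orthogonal /= !setI0.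
have neq1 X g : X \in SC -> g \in supp X -> g \in D ->
    exists2 h, h \in supp X :&: D & h != g.
  move=> XM gX gD; apply/exists_inP; case: (boolP [exists _ in _, _]) => // noh.
  case: (circuit_cocircuit_neq1 (e := g) (supp_circuit XM) DM); apply/setP=> x.
  apply/idP/set1P => [xXD|->]; last by rewrite inE gX.
  by apply/eqP; apply: contraNT noh => nxg; apply/exists_inP; exists x.
have link g : g \in D -> g != e ->
    exists2 X, X \in SC & supp X :&: D = [set e; g] /\ e \in X.1.
  move=> gD ge.
  have [||/exists_inP[_ /imsetP[X XM ->] /andP[eX sX]]|[D' DM' /andP[eD' sD']]] :=
    @circuit_or_cocircuit _ (underlying M) (~: D :|: [set e; g]) (D :\ g) e.
  - by apply/setP=> x; rewrite !inE; case: (x == g); case: (x \in D); rewrite ?orbT.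
  - apply/setP=> x; rewrite !inE; have [->|] := eqVneq x e; first by rewrite eq_sym ge eD orbT.
    by case: (x == g); case: (x \in D).
  - have eqXD : supp X :&: D = [set e; g].
      have sXD x : x \in supp X :&: D -> x \in [set e; g].
        by case/setIP=> /(subsetP sX); rewrite in_setU in_setC => /orP[/negPf->|].
      have [h hXD he] := neq1 X e XM eX eD.
      have hg : h = g by move: (sXD h hXD); rewrite !inE (negPf he) => /eqP.
      apply/eqP; rewrite {}hg in hXD; rewrite eqEsubset subUset !sub1set hXD inE eX eD !andbT.
      exact/subsetP.
    have := eX; rewrite in_supp => /orP[eX1|eX2]; first by exists X.
    by exists (opp_signed X); rewrite ?scircuits_opp ?supp_opp.
  move: DM; rewrite inE => /minsetP[_ /(_ D')].
  move: DM'; rewrite inE => /minsetP[-> _] /(_ isT (subset_trans sD' (subsetDl _ _))) eqD.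
  by have := subsetP sD' g; rewrite eqD gD !inE eqxx => /(_ isT).
pose linked g := [exists X in SC, [&& supp X :&: D == [set e; g], e \in X.1 & g \in X.2]].
pose P := [set g in D | (g == e) || linked g].
pose Y : {set E} * {set E} := (P, D :\: P).
have eP : e \in P by rewrite inE eD eqxx.
have signY X g : X \in SC -> g != e -> supp X :&: D = [set e; g] -> e \in X.1 ->
    (g \in X.2) = (g \in P).
  move=> XM ge eqX eX; have /setIP[gX gD] : g \in supp X :&: D by rewrite eqX !inE eqxx orbT.
  apply/idP/idP => [gX2|].
    by rewrite inE gD; apply/orP; right; apply/exists_inP; exists X; rewrite // eqX eX gX2 eqxx.
  rewrite inE gD (negPf ge) /= => /exists_inP[X' XM' /and3P[/eqP eqX' eX' gX']].
  move: gX; rewrite in_supp => /orP[gX|//].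
  have [| | |Z ZM [/set0Pn[x /setIP[xZ xD]] gZ Z1 Z2]] :=
    visible_elimination XM XM' gD _ (h := e).
  - by rewrite /opposed gX gX'.
  - by rewrite inE in_supp eX eD.
  - by rewrite /opposed (circuit_signN XM eX) (circuit_signN XM' eX') !andbF.
  have sZ y : y \in supp Z -> y \in D -> y = e.
    move=> yZ yD; have : y \in [set e; g].
      rewrite -(setUid [set e; g]) -{1}eqX -eqX' -setIUl inE yD andbT.
      move: yZ; rewrite [_ \in supp Z]in_supp => /orP[yZ|yZ].
        have := subsetP Z1 y; rewrite inE yZ yD => /(_ isT).
        by rewrite in_setU => /orP[] yX; rewrite in_setU !in_supp yX ?orbT.
      have := subsetP Z2 y; rewrite inE yZ yD => /(_ isT).
      by rewrite in_setU => /orP[] yX; rewrite in_setU !in_supp yX ?orbT.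
    by rewrite !inE => /orP[/eqP|/eqP yg] //; rewrite yg (negPf gZ) in yZ.
  have [h /setIP[hZ hD] hx] := neq1 Z x ZM xZ xD.
  by rewrite (sZ h hZ hD) (sZ x xZ xD) eqxx in hx.
(* Eliminating g by means of the circuit C linking it to e trades g for e, *)
(* so the trace on D :\ e strictly decreases while the signs remain those *)
(* of Y. *)
have noconf X : X \in SC -> supp X :&: D != set0 -> X.1 :&: D \subset Y.1 ->
    X.2 :&: D \subset Y.2 -> False.
  move: {2}_.+1 (ltnSn #|(supp X :&: D) :\ e|) => n.
  elim: n X => // n IHn X; rewrite ltnS => leX XM XD X1 X2.
  have [g gXD ge] : exists2 g, g \in supp X :&: D & g != e.
    have /set0Pn[x xXD] := XD; have [xe|] := eqVneq x e; last by exists x.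
    by have /setIP[xX xD] := xXD; rewrite -xe; apply: neq1.
  have /setIP[gX gD] := gXD.
  have [C CM [eqC eC]] := link g gD ge.
  have [h hXD hg] := neq1 X g XM gX gD; have /setIP[hX hD] := hXD.
  have sC x : x \in supp C -> x \in D -> x != g -> x = e.
    move=> xC xD xg; have : x \in [set e; g] by rewrite -eqC inE xC.
    by rewrite !inE (negPf xg) orbF => /eqP.
  have gC : g \in supp C by have /setIP[] : g \in supp C :&: D by rewrite eqC !inE eqxx orbT.
  have X1P x : x \in X.1 -> x \in D -> x \in P.
    by move=> xX xD; apply: (subsetP X1); rewrite inE xX.
  have X2P x : x \in X.2 -> x \in D -> x \notin P.
    by move=> xX xD; have := subsetP X2 x; rewrite !inE xX xD => /(_ isT) /andP[].
  have eX2 : e \in X.2 = false by apply/negP=> /X2P/(_ eD); rewrite eP.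
  have eC2 := circuit_signN CM eC.
  have gop : opposed X C g.
    have sg := signY C g CM ge eqC eC.
    move: gX; rewrite in_supp /opposed => /orP[gX|gX].
      by rewrite gX sg X1P.
    rewrite gX; move: gC; rewrite in_supp sg (negPf (X2P g gX gD)) orbF => ->.
    by rewrite orbT.
  have hop : ~~ opposed X C h.
    have [hC|hC] := boolP (h \in supp C).
      by rewrite (sC h hC hD hg) /opposed eX2 eC2 !andbF.
    by move: hC; rewrite in_supp /opposed => /norP[/negPf-> /negPf->]; rewrite !andbF.
  have [Z ZM [ZD gZ Z1 Z2]] := visible_elimination XM CM gD gop hXD hop.
  have Zg x : x \in supp Z -> x != g by apply: contraTneq => ->.
  have Z1D x : x \in Z.1 -> x \in D -> (x \in X.1) || (x == e).
    move=> xZ xD; have := subsetP Z1 x; rewrite in_setI xZ xD => /(_ isT).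
    rewrite in_setU => /orP[->//|xC]; rewrite (sC x) ?eqxx ?orbT ?Zg ?in_supp ?xC ?xZ //.
  have Z2D x : x \in Z.2 -> x \in D -> x \in X.2.
    move=> xZ xD; have := subsetP Z2 x; rewrite in_setI xZ xD => /(_ isT).
    rewrite in_setU => /orP[->//|xC]; move: (xC).
    by rewrite (sC x) ?eC2 ?Zg ?in_supp ?xC ?xZ ?orbT.
  apply: (IHn Z) => //.
  - apply: leq_trans leX; apply: proper_card; apply/properP; split; last first.
      by exists g; rewrite !inE ge ?gD ?gX ?andbT //= -in_setU.
    apply/subsetP=> x; rewrite !in_setD1 !in_setI => /and3P[xe xZ xD].
    rewrite xe xD andbT; move: xZ; rewrite [_ \in supp Z]in_supp => /orP[/Z1D|/Z2D]/(_ xD).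
      by rewrite (negPf xe) orbF in_supp => ->.
    by rewrite in_supp => ->; rewrite orbT.
  - apply/subsetP=> x /setIP[xZ xD]; have /orP[xX|/eqP->//] := Z1D x xZ xD.
    exact: X1P.
  - apply/subsetP=> x /setIP[xZ xD]; rewrite inE xD andbT; apply: X2P => //.
    exact: Z2D.
have sY : supp Y = D.
  apply/setP=> x; rewrite in_setU in_setD; case: (boolP (x \in P)) => //=.
  by rewrite inE => /andP[->].
have agree0 X : X \in SC -> (X.1 :&: Y.2) :|: (X.2 :&: Y.1) == set0 ->
    (X.1 :&: Y.1) :|: (X.2 :&: Y.2) == set0.
  move=> XM; rewrite setU_eq0 => /andP[/eqP/setP X12 /eqP/setP X21].
  have [XD|XD] := eqVneq (supp X :&: D) set0; last first.
    case: (noconf X XM XD); apply/subsetP=> x /setIP[xX xD].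
      by have := X12 x; rewrite !inE xX xD /= andbT => /negbFE.
    by have := X21 x; rewrite in_setI in_set0 xX !inE xD andbT /= => ->.
  apply/eqP/setP=> x; have /setP/(_ x) := XD.
  rewrite -sY in_setI !in_supp in_setU !in_setI in_set0.
  by case: (x \in X.1); case: (x \in X.2); case: (x \in Y.1); case: (x \in Y.2).
exists Y => //; rewrite inE sY DM /=; apply/andP; split.
  by rewrite /signed_set -setI_eq0 setIDA setIC -setIDA setDv setI0.
apply/forall_inP=> X XM; rewrite /Defs.orthogonal; apply/eqP; apply/idP/idP; last exact: agree0.
by rewrite setUC; move/(agree0 (opp_signed X) (scircuits_opp XM)); rewrite setUC.
Qed.

End CocircuitSignature.

(** * The painting property *)

Section Painting.
Variable E : finType.
Implicit Types (X Y : {set E} * {set E}) (A B L : {set E}) (e g : E).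
Implicit Types C D : {set {set E} * {set E}}.

(** X becomes nonnegative on B after reorientation on A. *)
Definition conform A B X : bool :=
  [forall g in B, ((g \in X.1) ==> (g \notin A)) && ((g \in X.2) ==> (g \in A))].

Definition through C L B A e : bool :=
  [exists X in C, [&& e \in supp X, supp X \subset L & conform A B X]].

(** The properties of signed circuits and cocircuits used for activities, chosen
    so that the notion is invariant under duality.  The last field is the
    painting property: elements outside L' may have any sign in the circuit and
    are absent from the cocircuit, elements outside L the other way round. *)
Record dual_pair C D : Prop := DualPair {
  dual_signedl : forall X, X \in C -> signed_set X;
  dual_signedr : forall Y, Y \in D -> signed_set Y;
  dual_oppl : forall X, X \in C -> opp_signed X \in C;
  dual_oppr : forall Y, Y \in D -> opp_signed Y \in D;
  dual_orthogonal : forall X Y, X \in C -> Y \in D -> Defs.orthogonal X Y;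
  dual_painting : forall L L' A e, L :|: L' = [set: E] -> e \in L :&: L' ->
    through C L (L :&: L') A e || through D L' (L :&: L') A e
}.

Lemma conformP A B X :
  reflect (forall g, g \in B -> (g \in X.1 -> g \notin A) /\ (g \in X.2 -> g \in A))
          (conform A B X).
Proof.
apply: (iffP forall_inP) => conf g gB.
  by have /andP[/implyP c1 /implyP c2] := conf g gB.
by have [c1 c2] := conf g gB; apply/andP; split; apply/implyP.
Qed.

Lemma conform_mono A1 A2 B1 B2 X :
    conform A1 B1 X ->
    (forall g, g \in B2 -> g \in supp X -> g \in B1 /\ (g \in A1) = (g \in A2)) ->
  conform A2 B2 X.
Proof.
move=> /conformP conf sB; apply/conformP=> g gB.
by split=> gX; (have [|gB1 <-] := sB g gB; first by rewrite in_supp gX ?orbT);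
  have [c1 c2] := conf g gB1; auto.
Qed.

Lemma through_mono C L1 L2 B1 B2 A1 A2 e :
    through C L1 B1 A1 e -> L1 \subset L2 ->
    (forall g, g \in B2 -> g \in L1 -> g \in B1 /\ (g \in A1) = (g \in A2)) ->
  through C L2 B2 A2 e.
Proof.
case/exists_inP=> X XC /and3P[eX sX cX] sL sB; apply/exists_inP; exists X => //.
rewrite eX (subset_trans sX) //=; apply: conform_mono cX _ => g gB gX.
exact: (sB g gB (subsetP sX g gX)).
Qed.

Definition toggle e A : {set E} := if e \in A then A :\ e else e |: A.

Lemma in_toggle e A g : (g \in toggle e A) = (g == e) (+) (g \in A).
Proof.
rewrite /toggle; have [->|ge] := eqVneq g e; last first.
  by case: ifP => eA; rewrite !inE ?ge ?(negPf ge).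
by case: ifP => eA; rewrite !inE eqxx ?eA.
Qed.

Lemma toggleK e : involutive (toggle e).
Proof. by move=> A; apply/setP=> g; rewrite !in_toggle addbA addbb. Qed.

(** X has at most one sign at e, and reorienting e corrects it. *)
Lemma conform_split A B X e : signed_set X -> conform A (B :\ e) X ->
  conform A B X \/ conform (toggle e A) B X.
Proof.
move=> sX cX.
have [eA|eA] := boolP ((e \in X.1) && (e \in A) || (e \in X.2) && (e \notin A)).
  right; apply/conformP=> g gB; rewrite in_toggle; have [->|ge] := eqVneq g e; last first.
    by have /conformP/(_ g) := cX; rewrite !inE ge gB; apply.
  move: eA; have [eX1|eX1] := boolP (e \in X.1).
    by rewrite (disjointFr sX eX1) /= orbF => ->.
  by have [eX2|eX2] := boolP (e \in X.2); rewrite //= => ->.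
left; apply/conformP=> g gB; have [->|ge] := eqVneq g e; last first.
  by have /conformP/(_ g) := cX; rewrite !inE ge gB; apply.
by move: eA; case: (e \in X.1); case: (e \in X.2); case: (e \in A).
Qed.

(** On B the signs of X and Y agree wherever both are nonzero, so orthogonality
    leaves them no common element. *)
Lemma orthogonal_conform A B X Y g :
    Defs.orthogonal X Y -> conform A B X -> conform A B Y ->
    supp X :&: supp Y \subset B -> g \in supp X -> g \notin supp Y.
Proof.
move=> /eqP orXY /conformP cX /conformP cY sB gX; apply/negP=> gY.
have inB h : h \in supp X -> h \in supp Y -> h \in B.
  by move=> hX hY; apply: (subsetP sB); rewrite inE hX.
have : (X.1 :&: Y.2) :|: (X.2 :&: Y.1) == set0.
  apply/eqP/setP=> h; rewrite !inE; apply/negP=> /orP[]/andP[hX hY].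
    have hB : h \in B by apply: inB; rewrite in_supp ?hX ?hY ?orbT.
    by have [_ /(_ hY)] := cY h hB; have [/(_ hX)/negPf->] := cX h hB.
  have hB : h \in B by apply: inB; rewrite in_supp ?hX ?hY ?orbT.
  by have [_ /(_ hX)] := cX h hB; have [/(_ hY)/negPf->] := cY h hB.
rewrite -orXY => /eqP/setP/(_ g).
have [cX1 cX2] := cX g (inB g gX gY); have [cY1 cY2] := cY g (inB g gX gY).
rewrite !inE; move: gX gY; rewrite !in_supp => /orP[]gX /orP[]gY.
- by rewrite gX gY.
- by have := cX1 gX; rewrite cY2.
- by have := cY1 gY; rewrite cX2.
- by rewrite gX gY orbT.
Qed.

Lemma orthogonalC X Y : Defs.orthogonal X Y = Defs.orthogonal Y X.
Proof.
rewrite /Defs.orthogonal (setIC X.1) (setIC X.2) (setIC X.1) (setIC X.2).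
by rewrite (setUC (Y.2 :&: _)).
Qed.

Lemma dual_pair_sym C D : dual_pair C D -> dual_pair D C.
Proof.
case=> sC sD oC oD orCD paint; split=> //.
  by move=> X Y XD YC; rewrite orthogonalC; apply: orCD.
by move=> L L' A e LL' eLL'; rewrite orbC setIC; apply: paint; rewrite 1?setUC 1?setIC.
Qed.

End Painting.

Section CircuitsAndCocircuits.
Variables (E : finType) (M : oriented_matroid E).
Implicit Types (X Y : {set E} * {set E}) (A B L : {set E}) (e g : E).
Implicit Types C D : {set {set E} * {set E}}.
Local Notation SC := (signed_circuits M).
Local Notation SD := (signed_cocircuits M).

Lemma scocircuits_signed Y : Y \in SD -> signed_set Y.
Proof. by rewrite inE => /and3P[]. Qed.

Lemma orthogonal_opp X Y : Defs.orthogonal X (opp_signed Y) = Defs.orthogonal X Y.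
Proof. by rewrite /Defs.orthogonal /= eq_sym. Qed.

Lemma scocircuits_opp Y : Y \in SD -> opp_signed Y \in SD.
Proof.
rewrite !inE supp_opp /signed_set disjoint_sym => /and3P[-> -> /forall_inP oY] /=.
by apply/forall_inP=> X XM; rewrite orthogonal_opp oY.
Qed.

Lemma scocircuits_orthogonal X Y : X \in SC -> Y \in SD -> Defs.orthogonal X Y.
Proof. by move=> XM; rewrite inE => /and3P[_ _ /forall_inP/(_ X XM)]. Qed.

Lemma through_conform1 C L A e X :
    (forall X, X \in C -> signed_set X) -> (forall X, X \in C -> opp_signed X \in C) ->
    X \in C -> e \in supp X -> supp X \subset L ->
  through C L [set e] A e.
Proof.
move=> sC oC XC eX sX.
have [] := @conform_split _ A [set e] X e (sC X XC).
- by apply/conformP=> g; rewrite !inE; case: eqP.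
- by move=> cX; apply/exists_inP; exists X; rewrite // eX sX.
move=> /conformP cX; apply/exists_inP; exists (opp_signed X); first exact: oC.
rewrite supp_opp eX sX /=; apply/conformP=> _ /set1P->.
have [] := cX e (set11 e); rewrite in_toggle eqxx /= negbK => c1 c2.
by split.
Qed.

(** Let f be another element of P = L :&: L'.  Contracting f gives a circuit or a
    cocircuit with the right signs on P :\ f; a cocircuit is what is wanted, as it
    avoids f.  Deleting f likewise gives a cocircuit or a suitable circuit.  In
    the remaining case there are a circuit and a cocircuit that both have the
    wrong sign at f: they have the same signs on P and share e, against
    orthogonality. *)
Lemma circuits_dual_pair : dual_pair SC SD.
Proof.
split; [exact: scircuits_signed | exact: scocircuits_signed | exact: scircuits_opp
  | exact: scocircuits_opp | exact: scocircuits_orthogonal |].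
move=> L L' A e; move: {2}_.+1 (ltnSn #|L :&: L'|) => n.
elim: n L L' => // n IHn L L'; rewrite ltnS => leP LL' eP.
have [f /andP[fP fe]|noP] := pickP (fun f => (f \in L :&: L') && (f != e)).
  have /setIP[fL fL'] := fP; have /setIP[eL eL'] := eP.
  have ltP : #|(L :&: L') :\ f| < n by move: leP; rewrite (cardsD1 f) fP.
  have /orP[/exists_inP[X XM /and3P[eX sX cX]]|thD] : through SC L ((L :&: L') :\ f) A e ||
      through SD (L' :\ f) ((L :&: L') :\ f) A e.
  - rewrite -setIDA in ltP *; apply: IHn => //; last by rewrite !inE eL eL' eq_sym fe.
    by apply/setP=> x; rewrite -LL' !inE; case: eqP => [->|]; rewrite ?fL.
  - have [cX'|cX'] := conform_split (scircuits_signed XM) cX.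
      by apply/orP; left; apply/exists_inP; exists X; rewrite // eX sX.
    have /orP[thC|/exists_inP[Y YM /and3P[eY sY cY]]] :
        through SC (L :\ f) ((L :&: L') :\ f) A e || through SD L' ((L :&: L') :\ f) A e.
    + have eqI : (L :&: L') :\ f = (L :\ f) :&: L' by rewrite [RHS]setIC setIDA (setIC L').
      rewrite eqI in ltP *; apply: IHn => //; last by rewrite !inE eL eL' eq_sym fe.
      by apply/setP=> x; rewrite -LL' !inE; case: eqP => [->|]; rewrite ?fL' ?orbT.
    + apply/orP; left; apply: through_mono thC (subsetDl _ _) _ => x xP.
      by rewrite !inE => /andP[xf _]; rewrite xf -in_setI.
    have [cY'|cY'] := conform_split (scocircuits_signed YM) cY.
      by apply/orP; right; apply/exists_inP; exists Y; rewrite // eY sY.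
    have /negP[] := orthogonal_conform (scocircuits_orthogonal XM YM) cX' cY' (setISS sX sY) eX.
    exact: eY.
  apply/orP; right; apply: through_mono thD (subsetDl _ _) _ => x xP.
  by rewrite !inE => /andP[xf _]; rewrite xf -in_setI.
have eqP : L :&: L' = [set e].
  apply/setP=> x; rewrite in_set1; apply/idP/eqP=> [xP|-> //].
  by have := noP x; rewrite xP => /negbFE/eqP.
rewrite eqP; have [/exists_inP[_ /imsetP[X XM ->] /andP[eX sX]]|[D DM /andP[eD sD]]] :=
  circuit_or_cocircuit (underlying M) LL' eqP.
  by rewrite (through_conform1 A (@scircuits_signed _ M) (@scircuits_opp _ M) XM eX sX).
have [Y YM sY] := signed_cocircuit_exists DM; rewrite -sY in eD sD.
by rewrite (through_conform1 A scocircuits_signed scocircuits_opp YM eD sD) orbT.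
Qed.
End CircuitsAndCocircuits.

(** * Activities in minors *)

Section MinorActivity.
Variables (disp : Order.disp_t) (E : finOrderType disp).
Implicit Types (X Y : {set E} * {set E}) (A B L P : {set E}) (e f g : E).
Implicit Types C D : {set {set E} * {set E}}.

(** Elements outside P, being contracted, are not subject to the order. *)
Definition above L P f : {set E} := L :\: [set g in P | (g < f)%O].

Definition active C L P A : {set E} := [set f in P | through C (above L P f) P A f].

Lemma in_above L P f g : (g \in above L P f) = (g \in L) && ((g \in P) ==> (f <= g)%O).
Proof. by rewrite in_setD in_set andbC negb_and -leNgt implybE. Qed.

Lemma in_active C L P A f :
  (f \in active C L P A) = (f \in P) && through C (above L P f) P A f.
Proof. by rewrite in_set. Qed.

Section OneSide.
Variables (C D : {set {set E} * {set E}}) (dCD : dual_pair C D).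
Variables (L L' : {set E}) (LL' : L :|: L' = [set: E]) (e : E).
Hypotheses (eP : e \in L :&: L') (emax : forall f, f \in L :&: L' -> (f <= e)%O).
Local Notation P := (L :&: L').
Local Notation O := (active C L P).
Local Notation O' := (active D L' P).

Lemma above_max f : f \in P -> above L (P :\ e) f = above L P f.
Proof.
move=> fP; apply/setP=> g; rewrite !in_above in_setD1.
by case: eqVneq => [->|]; rewrite //= emax // implybT.
Qed.

Lemma above_maxD f : f \in P -> above (L :\ e) (P :\ e) f = above L P f :\ e.
Proof.
move=> fP; apply/setP=> g; rewrite in_setD1 !in_above !in_setD1.
by case: eqVneq.
Qed.

Lemma above_antimono f g : (f <= g)%O -> above L P g \subset above L P f.
Proof.
move=> fg; apply/subsetP=> h; rewrite !in_above => /andP[-> /=].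
by case: (h \in P) => //=; apply: le_trans.
Qed.

Lemma activeP A f : reflect (f \in P /\ exists2 X, X \in C &
    [/\ f \in supp X, supp X \subset above L P f & conform A P X])
  (f \in O A).
Proof.
rewrite in_active; apply: (iffP andP) => -[fP].
  by case/exists_inP=> X XC /and3P[? ? ?]; split=> //; exists X.
by case=> X XC [? ? ?]; split=> //; apply/exists_inP; exists X => //; apply/and3P.
Qed.

(** Apply painting with e deleted.  A cocircuit Y through f with the right signs
    away from e cannot have the sign of X1 at e, since it shares f with X1; hence
    it contains e with the opposite sign, which makes it share f or e with X2 and
    agree with X2 everywhere. *)
Lemma active_elimination A f X1 X2 :
    f \in P :\ e ->
    X1 \in C -> f \in supp X1 -> supp X1 \subset above L P f -> conform A P X1 ->
    X2 \in C -> supp X2 \subset above L P f -> conform (toggle e A) P X2 ->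
    (f \in supp X2) || (e \in supp X2) ->
  f \in active C (L :\ e) (P :\ e) A.
Proof.
move=> fPe X1C fX1 sX1 cX1 X2C sX2 cX2 feX2.
have /setD1P[fe fP] := fPe; have /setIP[fL fL'] := fP; have /setIP[eL eL'] := eP.
rewrite in_active fPe above_maxD //=.
set T := above L P f in sX1 sX2 *; set L1 := T :\ e.
have L1L' : L1 :|: L' = setT.
  apply/setP=> x; have : x \in L :|: L' by rewrite LL' in_setT.
  rewrite in_setT /L1 /T !in_setU in_setD1.
  rewrite in_above in_setI; case: eqVneq => [->|_]; first by rewrite eL'.
  by case: (x \in L); case: (x \in L'); rewrite ?orbT.
have fL1 : f \in L1 :&: L' by rewrite inE fL' in_setD1 fe in_above fL lexx implybT.
have sTP : T :&: L' \subset P.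
  by apply/subsetP=> x; rewrite !in_setI in_above => /andP[/andP[-> _]].
case/orP: (dual_painting dCD A L1L' fL1) => [th|/exists_inP[Y YD /and3P[fY sY cY]]].
  apply: through_mono th (subxx _) _ => g; rewrite in_setD1 !in_setI => /and3P[_ _ ->].
  by move=> ->.
have cont : ~ conform A (T :&: L') Y.
  have cX : conform A (T :&: L') X1 by apply: conform_mono cX1 _ => g /(subsetP sTP).
  have orXY := dual_orthogonal dCD X1C YD.
  by move/(orthogonal_conform orXY cX)/(_ (setISS sX1 sY) fX1); rewrite fY.
have cY' : conform A (T :&: L' :\ e) Y by rewrite setIC -setIDA setIC.
have [//|cYA] := conform_split (dual_signedr dCD YD) cY'.
have noY2 g : g \in supp X2 -> g \notin supp Y.
  have cX : conform (toggle e A) (T :&: L') X2.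
    by apply: conform_mono cX2 _ => h /(subsetP sTP).
  exact: orthogonal_conform (dual_orthogonal dCD X2C YD) cX cYA (setISS sX2 sY).
case/orP: feX2 => [/noY2|/noY2 eY]; first by rewrite fY.
case: cont; apply: conform_mono cYA _ => g gT gY; split=> //.
by rewrite in_toggle; case: eqVneq => // ge; rewrite ge (negPf eY) in gY.
Qed.

Lemma active_contract A : active C L (P :\ e) A = (O A :|: O (toggle e A)) :\ e.
Proof.
apply/setP=> f; rewrite in_setD1 in_setU !in_active in_setD1.
have [//|fe] := eqVneq f e; have [fP|//] := boolP (f \in P); rewrite above_max //=.
apply/idP/orP => [/exists_inP[X XC /and3P[fX sX cX]]|].
  have [c|c] := conform_split (dual_signedl dCD XC) cX; [left|right];
    by apply/exists_inP; exists X; rewrite // fX sX.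
have sub g : g \in P :\ e -> (g \in P) /\ (g \in toggle e A) = (g \in A).
  by rewrite in_setD1 => /andP[ge ->]; rewrite in_toggle (negPf ge).
by case=> th; apply: through_mono th (subxx _) _ => g /sub[].
Qed.

Lemma active_delete A : active C (L :\ e) (P :\ e) A = (O A :&: O (toggle e A)) :\ e.
Proof.
apply/setP=> f; rewrite in_setD1 in_setI; apply/idP/and3P.
  rewrite in_active in_setD1 => /andP[/andP[fe fP]]; rewrite above_maxD // => th.
  have sub B : (forall g, g != e -> (g \in A) = (g \in B)) -> f \in O B.
    move=> AB; rewrite in_active fP; apply: through_mono th (subsetDl _ _) _ => g gP.
    by rewrite !in_setD1 gP => /andP[ge _]; rewrite ge AB.
  by split=> //; apply: sub => // g ge; rewrite in_toggle (negPf ge).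
case=> fe /activeP[fP [X1 X1C [fX1 sX1 cX1]]] /activeP[_ [X2 X2C [fX2 sX2 cX2]]].
by apply: (active_elimination _ X1C fX1 sX1 cX1 X2C) => //; rewrite ?in_setD1 ?fe ?fX2.
Qed.

(** A witness avoiding e would serve both reorientations. *)
Lemma active_toggle_witness A f :
    f \in O A -> f \notin O (toggle e A) ->
  exists2 X, X \in C &
    [/\ e \in supp X, f \in supp X, supp X \subset above L P f & conform A P X].
Proof.
case/activeP=> fP [X XC [fX sX cX]] nf; exists X => //; split=> //.
apply: contraNT nf => eX; apply/activeP; split=> //; exists X => //; split=> //.
apply: conform_mono cX _ => g gP gX; split=> //; rewrite in_toggle.
by case: eqVneq => // ge; rewrite -ge gX in eX.
Qed.

Lemma active_toggle_transfer A f X :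
    f \in O A :\ e -> X \in C -> e \in supp X -> supp X \subset above L P f ->
    conform (toggle e A) P X ->
  f \in O (toggle e A).
Proof.
case/setD1P=> fe /activeP[fP [X1 X1C [fX1 sX1 cX1]]] XC eX sX cX.
have : f \in active C (L :\ e) (P :\ e) A.
  by apply: (active_elimination _ X1C fX1 sX1 cX1 XC sX cX); rewrite ?eX ?orbT // in_setD1 fe.
by rewrite active_delete => /setD1P[_ /setIP[]].
Qed.

(** The witnesses for f and g have opposite signs at e; since f <= g the second
    one lies in the range allowed for f, so e can be eliminated. *)
Lemma active_comparable_le A f g :
    f \in O A :\ e -> f \notin O (toggle e A) ->
    g \in O (toggle e A) :\ e -> g \notin O A -> (f <= g)%O -> False.
Proof.
move=> fO nf /setD1P[_ gO] ng fg.
have [|X XC [eX gX sX cX]] := active_toggle_witness gO; first by rewrite toggleK.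
case/negP: nf; apply: (active_toggle_transfer fO XC eX _ cX).
exact: subset_trans sX (above_antimono fg).
Qed.

Lemma active_comparable A f g :
    f \in O A :\ e -> f \notin O (toggle e A) ->
    g \in O (toggle e A) :\ e -> g \notin O A -> False.
Proof.
move=> fO nf gO ng; have [fg|/ltW gf] := leP f g; first exact: active_comparable_le fO nf gO ng fg.
have := @active_comparable_le (toggle e A) g f.
by rewrite toggleK; apply.
Qed.

(** The only element of P in a witness is e, so its sign can be chosen. *)
Lemma active_max A B : e \in O A -> e \in O B.
Proof.
case/activeP=> _ [X XC [eX sX _]]; rewrite in_active eP /=.
have th := through_conform1 B (dual_signedl dCD) (dual_oppl dCD) XC eX sX.
apply: through_mono th (subxx _) _ => g gP; rewrite in_above gP => /andP[_ eg].
by split=> //; rewrite in_set1 eq_le emax.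
Qed.

Lemma active_max_toggle A : e \in O A -> O A :\ e \subset O (toggle e A).
Proof.
move/(active_max (toggle e A)); case/activeP=> _ [X XC [eX sX cX]].
apply/subsetP=> f fO; apply: (active_toggle_transfer fO XC eX _ cX).
by apply: subset_trans sX (above_antimono _); case/setD1P: fO => _ /activeP[/emax].
Qed.

End OneSide.

Section TwoSides.
Variables (C D : {set {set E} * {set E}}) (dCD : dual_pair C D).
Variables (L L' : {set E}) (LL' : L :|: L' = [set: E]) (e : E).
Hypotheses (eP : e \in L :&: L') (emax : forall f, f \in L :&: L' -> (f <= e)%O).
Local Notation P := (L :&: L').
Local Notation O := (active C L P).
Local Notation O' := (active D L' P).

Lemma conform_disjoint A X Y :
    X \in C -> supp X \subset L -> conform A P X ->
    Y \in D -> supp Y \subset L' -> conform A P Y ->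
  e \in supp X -> e \notin supp Y.
Proof.
move=> XC sX cX YD sY cY.
exact: orthogonal_conform (dual_orthogonal dCD XC YD) cX cY (setISS sX sY).
Qed.

Lemma above_sub K Q f : above K Q f \subset K. Proof. exact: subsetDl. Qed.

Lemma toggle_witness_dual A f :
    f \in O' A -> f \notin O' (toggle e A) ->
  exists2 Y, Y \in D & [/\ e \in supp Y, supp Y \subset L' & conform A P Y].
Proof.
rewrite (setIC L) => fO nf.
have [Y YD [eY _ sY cY]] := active_toggle_witness fO nf.
by exists Y; rewrite // eY (subset_trans sY) ?above_sub // setIC.
Qed.

(** The two witnesses would both contain e with the sign prescribed by A. *)
Lemma active_opposite A f g :
    f \in O A -> f \notin O (toggle e A) -> g \in O' A -> g \notin O' (toggle e A) -> False.
Proof.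
move=> fO nf gO ng; have [X XC [eX _ sX cX]] := active_toggle_witness fO nf.
have [Y YD [eY sY cY]] := toggle_witness_dual gO ng.
have := conform_disjoint XC (subset_trans sX (above_sub _ _ _)) cX YD sY cY eX.
by rewrite eY.
Qed.

(** A cocircuit containing e with the sign prescribed by A would meet the
    witness for e against orthogonality; so the witness for f avoids e and
    serves both reorientations. *)
Lemma active_max_excl A f : e \in O A -> f \in O' A -> f \in O' (toggle e A).
Proof.
case/activeP=> _ [X XC [eX sX cX]] fO.
case: (boolP (f \in O' (toggle e A))) => // nf.
have [Y YD [eY sY cY]] := toggle_witness_dual fO nf.
have := conform_disjoint XC (subset_trans sX (above_sub _ _ _)) cX YD sY cY eX.
by rewrite eY.
Qed.

Lemma active_max_incompatible A : e \in O A -> e \notin O' A.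
Proof.
case/activeP=> _ [X XC [eX sX cX]]; apply/negP; rewrite (setIC L).
case/activeP=> _ [Y YD [eY sY cY]]; rewrite (setIC L') in cY.
have := conform_disjoint XC (subset_trans sX (above_sub _ _ _)) cX YD
  (subset_trans sY (above_sub _ _ _)) cY eX.
by rewrite eY.
Qed.

End TwoSides.

Section Step.
Variables (C D : {set {set E} * {set E}}) (dCD : dual_pair C D).
Variables (L L' : {set E}) (LL' : L :|: L' = [set: E]) (e : E).
Hypotheses (eP : e \in L :&: L') (emax : forall f, f \in L :&: L' -> (f <= e)%O).
Local Notation P := (L :&: L').
Local Notation O := (active C L P).
Local Notation O' := (active D L' P).

Let dDC : dual_pair D C := dual_pair_sym dCD.
Let L'L : L' :|: L = [set: E]. Proof. by rewrite setUC. Qed.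
Let eP' : e \in L' :&: L. Proof. by rewrite setIC. Qed.
Let emax' f : f \in L' :&: L -> (f <= e)%O. Proof. by rewrite setIC; apply: emax. Qed.
Let PC : L' :&: L = L :&: L'. Proof. exact: setIC. Qed.

Lemma active_dual_contract A :
  active D (L' :\ e) (P :\ e) A = (O' A :&: O' (toggle e A)) :\ e.
Proof. by have := active_delete dDC L'L eP' A; rewrite PC. Qed.

Lemma active_dual_delete A :
  active D L' (P :\ e) A = (O' A :|: O' (toggle e A)) :\ e.
Proof. by have := active_contract dDC emax' A; rewrite PC. Qed.

(** Two elements lost and gained in O, or in O^*, are excluded by
    [active_comparable]; losing one in O and one in O^* at the same time is
    excluded by [active_opposite]. *)
Lemma toggle_nested A :
  (O (toggle e A) :\ e \subset O A :\ e) /\ (O' A :\ e \subset O' (toggle e A) :\ e) \/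
  (O A :\ e \subset O (toggle e A) :\ e) /\ (O' (toggle e A) :\ e \subset O' A :\ e).
Proof.
have subP (S T : {set E}) : reflect (forall f, f \in S :\ e -> f \in T) (S :\ e \subset T :\ e).
  apply: (iffP subsetP) => sST f fS; first by have /setD1P[] := sST f fS.
  by rewrite in_setD1 (sST f fS) andbT; case/setD1P: fS.
have nsubP (S T : {set E}) : S :\ e \subset T :\ e \/ exists2 f, f \in S :\ e & f \notin T.
  have [|/subsetPn[f fS]] := boolP (S :\ e \subset T :\ e); first by left.
  by rewrite in_setD1 negb_and negbK => /orP[/eqP fe|fT];
    [rewrite fe setD11 in fS | right; exists f].
have inD (S : {set E}) f : f \in S :\ e -> f \in S by case/setD1P.
have comp' f g : f \in O' A :\ e -> f \notin O' (toggle e A) ->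
    g \in O' (toggle e A) :\ e -> g \notin O' A -> False.
  by have := @active_comparable _ _ dDC _ _ L'L _ eP' A f g; rewrite PC.
have opp f g : f \in O (toggle e A) -> f \notin O A ->
    g \in O' (toggle e A) -> g \notin O' A -> False.
  by have := @active_opposite _ _ dCD L L' e (toggle e A) f g; rewrite toggleK.
have [s1|[f f1 f2]] := nsubP (O (toggle e A)) (O A).
  have [s2|[g g1 g2]] := nsubP (O' A) (O' (toggle e A)); first by left.
  right; split; apply/subP=> h h1; apply/negPn/negP=> h2.
    exact: @active_opposite _ _ dCD L L' e A h g (inD _ _ h1) h2 (inD _ _ g1) g2.
  exact: comp' g1 g2 h1 h2.
right; split; apply/subP=> h h1; apply/negPn/negP=> h2.
  exact: @active_comparable _ _ dCD L L' LL' e eP A h f h1 h2 f1 f2.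
exact: opp (inD _ _ f1) f2 (inD _ _ h1) h2.
Qed.

Lemma active_minors A :
  [/\ active C L (P :\ e) A = O A :\ e, active D (L' :\ e) (P :\ e) A = O' A :\ e,
      active C (L :\ e) (P :\ e) A = O (toggle e A) :\ e &
      active D L' (P :\ e) A = O' (toggle e A) :\ e] \/
  [/\ active C L (P :\ e) A = O (toggle e A) :\ e,
      active D (L' :\ e) (P :\ e) A = O' (toggle e A) :\ e,
      active C (L :\ e) (P :\ e) A = O A :\ e & active D L' (P :\ e) A = O' A :\ e].
Proof.
rewrite (active_contract dCD emax) (active_delete dCD LL' eP).
rewrite active_dual_contract active_dual_delete !setDUl !setDIl.
case: (toggle_nested A) => -[s1 s2]; [left | right].
  by rewrite (setUidPl s1) (setIidPl s2) (setIidPr s1) (setUidPr s2).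
by rewrite (setUidPr s1) (setIidPr s2) (setIidPl s1) (setUidPl s2).
Qed.

(** The case of a loop or a coloop: a witness for e alone, taken with either
    sign, transfers activity between the two reorientations on its own side, and
    by orthogonality no witness on the other side contains e. *)
Lemma active_max_trivial A : (e \in O A) || (e \in O' A) ->
  O A :\ e = O (toggle e A) :\ e /\ O' A :\ e = O' (toggle e A) :\ e.
Proof.
have eqD (S T : {set E}) : (forall f, f \in S :\ e -> f \in T) ->
    (forall f, f \in T :\ e -> f \in S) -> S :\ e = T :\ e.
  move=> ST TS; apply/setP=> f; apply/idP/idP => fST; have /setD1P[fe _] := fST.
    by rewrite in_setD1 fe ST.
  by rewrite in_setD1 fe TS.
have inD (S : {set E}) f : f \in S :\ e -> f \in S by case/setD1P.
case/orP=> eO.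
  have eO1 := active_max dCD eP emax (toggle e A) eO.
  split; apply: eqD => f fO.
  - exact: (subsetP (active_max_toggle dCD LL' eP emax eO)).
  - by rewrite -(toggleK e A); apply: (subsetP (active_max_toggle dCD LL' eP emax eO1)).
  - exact (active_max_excl dCD eO (inD _ _ fO)).
  - by rewrite -(toggleK e A); exact (active_max_excl dCD eO1 (inD _ _ fO)).
rewrite -!PC in eO *; have eO1 := active_max dDC eP' emax' (toggle e A) eO.
split; apply: eqD => f fO.
- exact (active_max_excl dDC eO (inD _ _ fO)).
- by rewrite -(toggleK e A); exact (active_max_excl dDC eO1 (inD _ _ fO)).
- exact: (subsetP (active_max_toggle dDC L'L eP' emax' eO)).
- by rewrite -(toggleK e A); apply: (subsetP (active_max_toggle dDC L'L eP' emax' eO1)).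
Qed.

End Step.

End MinorActivity.

(** * The two expansions *)

Section LoopsAndColoops.
Variables (disp : Order.disp_t) (E : finOrderType disp) (M : oriented_matroid E).
Implicit Types (A L S : {set E}) (e : E).
Local Notation SC := (signed_circuits M).
Local Notation SD := (signed_cocircuits M).

Lemma on_circuit_through L A e : on_circuit (underlying M) L e = through SC L [set e] A e.
Proof.
apply/exists_inP/exists_inP => [[_ /imsetP[X XM ->] /andP[eX sX]]|[X XM /and3P[eX sX _]]].
  apply/exists_inP; exact (through_conform1 A (@scircuits_signed _ M) (@scircuits_opp _ M) XM eX sX).
by exists (supp X); [exact: supp_circuit | rewrite eX].
Qed.

Lemma through_dual L L' A e : L :|: L' = [set: E] -> L :&: L' = [set e] ->
  through SD L' [set e] A e = ~~ through SC L [set e] A e.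
Proof.
move=> LL' eqe; have := dual_painting (circuits_dual_pair M) A LL' (e := e).
rewrite eqe set11 => /(_ isT); case thD: (through SD _ _ _ _); last by rewrite orbF => ->.
move=> _; apply/esym/negP=> /exists_inP[X XM /and3P[eX sX cX]].
case/exists_inP: thD => Y YM /and3P[eY sY cY].
have := orthogonal_conform (scocircuits_orthogonal XM YM) cX cY.
by rewrite -eqe => /(_ e (setISS sX sY) eX); rewrite eY.
Qed.

Lemma in_active_max C L L' A e : L :|: L' = [set: E] -> e \in L :&: L' ->
    (forall f, f \in L :&: L' -> (f <= e)%O) ->
  (e \in active C L (L :&: L') A) = through C (e |: ~: L') [set e] A e.
Proof.
move=> LL' eP emax; rewrite in_active eP /=.
have eqA : above L (L :&: L') e = e |: ~: L'.
  apply/setP=> g; have : g \in L :|: L' by rewrite LL' in_setT.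
  rewrite in_above in_setI in_setU in_setU1 in_setC.
  have [->|ge] /= := eqVneq g e; first by have /setIP[-> _] := eP; rewrite lexx implybT.
  have [gL|gL] := boolP (g \in L); case: (boolP (g \in L')) => //= gL' _.
  by apply/negbTE; rewrite -ltNge lt_neqAle ge emax //= inE gL gL'.
rewrite eqA; apply/idP/idP => th; apply: through_mono th (subxx _) _ => g.
  by move/set1P=> ->.
by rewrite in_set1 in_setU1 in_setC in_setI => /andP[_ ->]; rewrite orbF => ->.
Qed.

(** Thus e is active exactly when it is a loop of the minor. *)
Lemma active_max_loop L L' A e : L :|: L' = [set: E] -> e \in L :&: L' ->
    (forall f, f \in L :&: L' -> (f <= e)%O) ->
  (e \in active SC L (L :&: L') A) = on_circuit (underlying M) (e |: ~: L') e.
Proof. by move=> LL' eP emax; rewrite in_active_max // (on_circuit_through _ A). Qed.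

(** Dually, e is coactive exactly when it is a coloop of the minor. *)
Lemma active_max_coloop L L' A e : L :|: L' = [set: E] -> e \in L :&: L' ->
    (forall f, f \in L :&: L' -> (f <= e)%O) ->
  (e \in active SD L' (L :&: L') A) = ~~ on_circuit (underlying M) L e.
Proof.
move=> LL' eP emax; have /setIP[eL eL'] := eP.
rewrite (setIC L) (@in_active_max SD L' L); first 1 last.
- by rewrite setUC.
- by rewrite setIC.
- by move=> f; rewrite setIC; apply: emax.
rewrite (on_circuit_through _ A) (through_dual (L := L)) //.
  by apply/setP=> x; rewrite !inE; case: (x \in L); rewrite ?orbT.
by apply/setP=> x; rewrite !inE; case: eqVneq => [->|]; rewrite ?eL //= andbN.
Qed.

End LoopsAndColoops.

Lemma rankU (E : finType) (M : matroid E) (A B : {set E}) :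
  rank M (A :|: B) <= #|A| + rank M B.
Proof.
have [I [sI iI <-]] := rank_witness M (A :|: B).
rewrite -(cardsID A I) leq_add ?subset_leq_card ?subsetIr //.
by rewrite rank_ge ?subDset // (indep_sub _ iI) ?subsetDl.
Qed.

Local Open Scope ring_scope.

Lemma sum_subsets_D1 (E : finType) (V : nmodType) (P : {set E}) (e : E)
    (F : {set E} -> V) : e \in P ->
  \sum_(A : {set E} | A \subset P) F A =
  \sum_(A : {set E} | A \subset P :\ e) (F A + F (e |: A)).
Proof.
move=> eP; rewrite (bigID (fun A : {set E} => e \notin A)) big_split /=; congr (_ + _).
  by apply: eq_bigl => A; rewrite subsetD1.
rewrite (reindex_onto (fun A => e |: A) (fun A => A :\ e)) /=; last first.
  by move=> A /andP[_]; rewrite negbK => /setD1K.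
apply: eq_bigl => A; rewrite subUset sub1set eP setU11 /= andbT subsetD1.
by congr (_ && _); apply/eqP/idP => [<-|/setU1K//]; rewrite setD11.
Qed.

Section Expansion.
Variables (disp : Order.disp_t) (E : finOrderType disp) (M : oriented_matroid E).
Variables (R : comNzRingType) (a b : R).
Implicit Types (A L S T : {set E}) (e : E).
Local Notation SC := (signed_circuits M).
Local Notation SD := (signed_cocircuits M).
Local Notation r := (rank (underlying M)).

Definition weight T S A : R := a ^+ #|T :\: A| * b ^+ #|S :\: A|.

Definition activity_sum L L' : R :=
  \sum_(A : {set E} | A \subset L :&: L')
    weight (active SD L' (L :&: L') A) (active SC L (L :&: L') A) A.

(** The corank-nullity sum of the minor: its rank function sends S to
    r (S :|: ~: L') - r (~: L'). *)
Definition rank_sum L L' : R :=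
  \sum_(S : {set E} | S \subset L :&: L')
    a ^+ (r L - r (S :|: ~: L')) * b ^+ (#|S| + r (~: L') - r (S :|: ~: L')).

Lemma weightU1 e T S A : e \notin A ->
  weight T S A = a ^+ (e \in T) * b ^+ (e \in S) * weight (T :\ e) (S :\ e) A.
Proof.
have cD Q : e \notin A -> #|Q :\: A| = ((e \in Q) + #|(Q :\ e) :\: A|)%N.
  by move=> eA; rewrite (cardsD1 e) in_setD eA setDDl setUC -setDDl.
by move=> eA; rewrite /weight (cD T eA) (cD S eA) !exprD mulrACA.
Qed.

Lemma weight_toggle e T S A : weight T S (e |: A) = weight (T :\ e) (S :\ e) A.
Proof. by rewrite /weight !setDDl. Qed.

(** The exponents of a and b tell whether e is a coloop or a loop of the minor.
    In these cases the deletion and the contraction have the same activities;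
    otherwise [active_minors] matches the terms of A and e |: A with those of A
    in the two minors. *)
Lemma activity_sum_rec L L' e : L :|: L' = [set: E] -> e \in L :&: L' ->
    (forall f, f \in L :&: L' -> (f <= e)%O) ->
  activity_sum L L' =
  a ^+ (~~ on_circuit (underlying M) L e) * activity_sum (L :\ e) L' +
  b ^+ (on_circuit (underlying M) (e |: ~: L') e) * activity_sum L (L' :\ e).
Proof.
move=> LL' eP emax; have dSC := circuits_dual_pair M.
have PD : (L :\ e) :&: L' = (L :&: L') :\ e by rewrite setIC setIDA (setIC L').
rewrite /activity_sum PD setIDA (sum_subsets_D1 _ eP) !big_distrr -big_split /=.
apply: eq_bigr => A; rewrite subsetD1 => /andP[_ eA].
have eqT : e |: A = toggle e A by rewrite /toggle (negPf eA).
rewrite (weightU1 _ _ eA) weight_toggle eqT active_max_loop // active_max_coloop //.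
have := active_max_incompatible dSC (A := A) (L := L) (L' := L') (e := e).
have := active_max_trivial dSC LL' eP emax (A := A).
rewrite active_max_loop // active_max_coloop //.
have := active_minors dSC LL' eP emax A.
case: (on_circuit _ (_ |: _) _); case: (on_circuit _ L e) => /=.
- by case=> -[-> -> -> ->] /(_ isT)[-> ->] _; rewrite !expr0 !expr1 !mul1r addrC.
- by move=> _ _ /(_ isT).
- by case=> -[-> -> -> ->] _ _; rewrite !expr0 !mul1r // addrC.
- by case=> -[-> -> -> ->] /(_ isT)[-> ->] _; rewrite !expr0 !expr1 !mul1r mulr1.
Qed.

(** Separate the subsets S according to whether they contain e.  The rank lost
    from L to L :\ e, and the nullity gained from ~: L' to e |: ~: L', come out of
    the exponents. *)
Lemma rank_sum_rec L L' e : L :|: L' = [set: E] -> e \in L :&: L' ->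
  rank_sum L L' =
  a ^+ (~~ on_circuit (underlying M) L e) * rank_sum (L :\ e) L' +
  b ^+ (on_circuit (underlying M) (e |: ~: L') e) * rank_sum L (L' :\ e).
Proof.
move=> LL' eP; have /setIP[eL eL'] := eP.
have PD : (L :\ e) :&: L' = (L :&: L') :\ e by rewrite setIC setIDA (setIC L').
have GD : ~: (L' :\ e) = e |: ~: L' by rewrite setCD setUC.
have sGL : ~: L' \subset L :\ e.
  apply/subsetP=> x; have : x \in L :|: L' by rewrite LL' in_setT.
  rewrite !inE; case: eqVneq => [->|_]; first by rewrite eL'.
  by case: (x \in L) => //= ->.
rewrite /rank_sum PD setIDA (sum_subsets_D1 _ eP) !big_distrr -big_split /=.
apply: eq_bigr => S sS.
have eG : e \in e |: ~: L' by rewrite setU11.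
have := rankD1 (underlying M) eL; have := rankD1 (underlying M) eG.
rewrite setU1K ?inE ?eL' // => rG rL.
have eS : e \notin S by have := subsetP sS e; rewrite setD11 => /contraFN; apply.
rewrite GD cardsU1 eS -setUA (setUCA [set e]).
have leS : (r (S :|: ~: L') <= r (L :\ e))%N.
  by rewrite rankS // subUset sGL (subset_trans sS) // setSD // subsetIl.
have leU : (r (S :|: (e |: ~: L')) <= #|S| + r (e |: ~: L'))%N by apply: rankU.
rewrite mulrA -exprD mulrCA -exprD.
congr (_ * _ + _ * _); congr (_ ^+ _); first by rewrite rL addnC addnBA.
by move: rG leU; case: (on_circuit _ _ e) => /= -> leU; lia.
Qed.

Lemma activity_sum_rank_sum L L' :
  L :|: L' = [set: E] -> activity_sum L L' = rank_sum L L'.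
Proof.
move: {2}_.+1 (ltnSn #|L :&: L'|) => n.
elim: n L L' => // n IHn L L'; rewrite ltnS => leP LL'.
have [P0|[i iP]] := set_0Vmem (L :&: L').
  have eqL : L = ~: L'.
    apply/setP=> x; have : x \in L :|: L' by rewrite LL' in_setT.
    have /setP/(_ x) := P0; rewrite !inE.
    by case: (x \in L); case: (x \in L').
  rewrite /activity_sum /rank_sum P0.
  have big0 (F : {set E} -> R) : \sum_(A : {set E} | A \subset set0) F A = F set0.
    by rewrite (eq_bigl (pred1 set0)) ?big_pred1_eq // => A; rewrite subset0.
  rewrite !big0 set0U -eqL cards0 subnn /weight.
  have act0 C K : active C K set0 set0 = set0.
    by apply/setP=> x; rewrite in_active !in_set0.
  by rewrite !act0 set0D cards0.
have [e eP emax] : exists2 e, e \in L :&: L' & forall f, f \in L :&: L' -> (f <= e)%O.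
  by case: (@Order.TotalTheory.arg_maxP _ _ _ i (mem (L :&: L')) id iP) => e eP emax; exists e.
have ltP : (#|(L :&: L') :\ e| < n)%N by move: leP; rewrite (cardsD1 e) eP.
have /setIP[eL eL'] := eP.
rewrite (activity_sum_rec LL' eP emax) (rank_sum_rec LL' eP); congr (_ * _ + _ * _).
  apply: IHn; first by rewrite setIC setIDA (setIC L').
  by apply/setP=> x; rewrite -LL' !inE; case: eqVneq => [->|]; rewrite ?eL' ?orbT.
apply: IHn; first by rewrite setIDA.
by apply/setP=> x; rewrite -LL' !inE; case: eqVneq => [->|]; rewrite ?eL ?orbT.
Qed.

End Expansion.

Lemma positive_reverse_signs (E : finType) (A : {set E}) (X : {set E} * {set E}) :
  positive (reverse_signs A X) = conform A [set: E] X.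
Proof.
rewrite /positive /= setU_eq0 setD_eq0; apply/andP/conformP.
  by case=> /subsetP X2 /eqP/setP X1 g _; split=> gX; [have := X1 g; rewrite !inE gX /= => -> | exact: X2].
move=> cX; split; first by apply/subsetP=> g; have [_] := cX g (in_setT g).
apply/eqP/setP=> g; rewrite !inE; apply/negP=> /andP[gX gA].
by have [/(_ gX)] := cX g (in_setT g); rewrite gA.
Qed.

Lemma active_setT (disp : Order.disp_t) (E : finOrderType disp)
    (C : {set {set E} * {set E}}) (A : {set E}) :
  [set e | [exists X in [set reverse_signs A X | X in C],
              positive X && is_smallest e (supp X)]] = active C [set: E] [set: E] A.
Proof.
apply/setP=> e; rewrite in_set in_active in_setT /=.
have smallest X : is_smallest e (supp X) =
    (e \in supp X) && (supp X \subset above [set: E] [set: E] e).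
  congr (_ && _); apply/forall_inP/subsetP => sX f /sX; by rewrite in_above !in_setT.
apply/exists_inP/exists_inP => [[_ /imsetP[X XC ->]]|[X XC /and3P[eX sX cX]]].
  rewrite positive_reverse_signs smallest supp_reverse_signs => /and3P[cX eX sX].
  by exists X; rewrite // eX sX.
exists (reverse_signs A X); first exact: imset_f.
by rewrite positive_reverse_signs smallest supp_reverse_signs cX eX.
Qed.

Theorem corollary3p6 (disp : Order.disp_t) (E : finOrderType disp)
    (M : oriented_matroid E) (R : comNzRingType) (x y : R) :
  tutte (underlying M) x y =
  \sum_(A : {set E}) (x - 1) ^+ theta_star M A * (y - 1) ^+ theta M A.
Proof.
transitivity (rank_sum M (x - 1) (y - 1) [set: E] [set: E]).
  rewrite /tutte /rank_sum setIT setCT rank0; apply: eq_big => A; first by rewrite subsetT.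
  by rewrite setU0 addn0.
rewrite -activity_sum_rank_sum ?setUT // /activity_sum setIT.
apply: eq_big => A; first by rewrite subsetT.
by rewrite /weight /theta_star /theta /O_star_set signed_cocircuits_reorient /O_set /= !active_setT.
Qed.
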